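(* Let $a>0$ and let $k$ be a positive integer. Define \[J_{2k}(a)=\int_0^\infty\frac{x\,e^{-\pi a x^2}}{e^{2\pi x}-1}\,{}_1F_1\!\left(-2k;\tfrac{3}{2};2\pi a x^2\right)dx .\] Then \[J_{2k}(a)=T_{2k}(a)+\epsilon_{2k}(a),\] where \[T_{2k}(a)=\frac{1}{4\pi a}\left\{\left(\frac{1+a^{1/2}}{2}\right)\sqrt{\frac{\pi}{2}}\,\frac{\Gamma(2k+1)}{\Gamma(2k+\frac{3}{2})}-{}_2F_1\!\left(-2k,1;\tfrac{3}{2};2\right)\right\}\] and \[\epsilon_{2k}(a)=\frac{1}{4\pi a}\int_1^\infty \{\psi(t)+a^{1/2}\phi(t)\}\,\frac{(t-1)^{2k}}{(1+t)^{2k+3/2}}\,dt,\] with $\psi(t)=\sum_{n\ge1}e^{-\pi n^2 t/a}$ and $\phi(t)=\sum_{n\ge1}e^{-\pi n^2 a t}$.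
   Context: ${}_1F_1$ denotes Kummer's confluent hypergeometric function and ${}_2F_1$ the Gauss hypergeometric function; for the negative integer parameter $-2k$ both series terminate. *)

(* Defs.v *)
From Stdlib Require Import Reals.
From Coquelicot Require Import Coquelicot.
Open Scope R_scope.

Fixpoint poch (a : R) (n : nat) : R :=
  match n with
  | O => 1
  | S m => poch a m * (a + INR m)
  end.

Definition hyp1F1 (a b z : R) : R :=
  Series (fun n => poch a n / poch b n * z ^ n / INR (Factorial.fact n)).

(* Gauss hypergeometric function 2F1(a,b;c;z) = sum_n (a)_n (b)_n/(c)_n z^n/n!
   (as a series; for a a negative integer it terminates). *)
Definition hyp2F1 (a b c z : R) : R :=
  Series (fun n => poch a n * poch b n / poch c n * z ^ n / INR (Factorial.fact n)).

Definition Gamma (s : R) : R :=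
  RInt_gen (fun t => Rpower t (s - 1) * exp (- t)) (at_right 0) (Rbar_locally p_infty).

Definition J (k : nat) (a : R) : R :=
  RInt_gen (fun x => x * exp (- PI * a * x ^ 2) / (exp (2 * PI * x) - 1)
                      * hyp1F1 (- INR (2 * k)) (3 / 2) (2 * PI * a * x ^ 2))
           (at_right 0) (Rbar_locally p_infty).

Definition psi (a t : R) : R :=
  Series (fun n => exp (- PI * (INR (S n)) ^ 2 * t / a)).
Definition phi (a t : R) : R :=
  Series (fun n => exp (- PI * (INR (S n)) ^ 2 * a * t)).

Definition T (k : nat) (a : R) : R :=
  / (4 * PI * a) *
  ( ((1 + sqrt a) / 2) * sqrt (PI / 2)
      * (Gamma (INR (2 * k) + 1) / Gamma (INR (2 * k) + 3 / 2))
    - hyp2F1 (- INR (2 * k)) 1 (3 / 2) 2 ).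

Definition eps (k : nat) (a : R) : R :=
  / (4 * PI * a) *
  RInt_gen (fun t => (psi a t + sqrt a * phi a t)
                      * ((t - 1) ^ (2 * k) / Rpower (1 + t) (INR (2 * k) + 3 / 2)))
           (at_point 1) (Rbar_locally p_infty).

(* Main.v *)
Require Import Defs.
From Stdlib Require Import Reals Lra Lia.
From Coquelicot Require Import Coquelicot.
Open Scope R_scope.

(* Expanding [1 / (exp (2 PI x) - 1) = - 1/2 + 1/(2 PI x) + (1/PI) sum_n x / (x^2 + n^2)] reduces the
   integral to Gaussian moments and to the integrals of [x^2 p(x) / (x^2 + n^2)], where
   [p(x) = exp (- PI a x^2) 1F1(- N; 3/2; 2 PI a x^2)] and [N = 2k]. Writing [1 / (x^2 + n^2)] as
   the integral of [exp (- s (x^2 + n^2))] over [s = PI a t > 0], the Gaussian moments sum up by the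
   binomial theorem to the kernel [K(t) = (t - 1)^N / (1 + t)^(N + 3/2)], so the sum over [n] is the
   integral of [phi K] over [(0, oo)] up to a factor. Since [N] is even,
   [K(1/t) / t^2 = K(t) / sqrt t], and the functional equation of theta folds [(0, 1)] onto
   [(1, oo)], turning [phi] into [psi] and leaving elementary integrals of [K].
   Both the partial fractions and the theta functional equation come from pointwise convergence of
   Fourier series for continuously differentiable functions. *)


(* Coquelicot leaves equations typed in a normed module, where [ring] and [field] fail. *)
Ltac eqR := match goal with |- ?a = ?b => change (@eq R a b) end.

(** The obstacle is the interchange of limits. Since [p] changes sign, every interchange is done for
    one monomial at a time, whose integrand is nonnegative on the half-line; the [N + 1] monomials
    are recombined only afterwards. In place of a double integral stands a function of [s], the
    integral over [x] of [x^m exp (- b x^2) exp (- b s (x^2 + y)) / (x^2 + y)]. Its derivative in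
    [s] has no denominator left and is a Gaussian moment up to a factor, so the fundamental theorem
    of calculus does the work of Fubini.

    The integral of [phi K] is never evaluated: [J] and [eps] are both reduced to the same finite
    combination of sums over [n], which cancels. What remains are integrals of [(1 - 2 s^2)^N] over
    [[0, w]], the form that [K] takes under [s = 1 / sqrt (1 + t)]. The one with [w = 1] ([t = 0])
    occurs in both and cancels as well; the one with [w = 1 / sqrt 2] ([t = 1]) is the Gamma
    quotient of [T].

    Improper integrals are taken of functions continuous on the whole line, so the Bose factor is
    first replaced by its continuous extension through [0]. *)

Definition cont (f : R -> R) : Prop := forall x, continuous f x.

Lemma is_derive_eq (f : R -> R) (x l l' : R) :
  is_derive f x l -> l = l' -> is_derive f x l'.
Proof. intros H <-; exact H. Qed.

Lemma ex_derive_cont (f : R -> R) (x : R) : ex_derive f x -> continuous f x.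
Proof. exact (ex_derive_continuous f x). Qed.

Lemma exp_le_exp (x y : R) : x <= y -> exp x <= exp y.
Proof. intros [H| ->]; [left; apply exp_increasing; auto|lra]. Qed.

Lemma cont_ex_RInt (f : R -> R) (a b : R) : cont f -> ex_RInt f a b.
Proof. intros H; apply (ex_RInt_continuous f); intros; apply H. Qed.

Lemma cont_add (f g : R -> R) : cont f -> cont g -> cont (fun x => f x + g x).
Proof. intros Hf Hg x; apply (continuous_plus f g x); auto. Qed.

Lemma cont_mul (f g : R -> R) : cont f -> cont g -> cont (fun x => f x * g x).
Proof. intros Hf Hg x; apply (continuous_mult f g x); auto. Qed.

Lemma RInt_add (f g : R -> R) (a b : R) : ex_RInt f a b -> ex_RInt g a b ->
  RInt (fun x => f x + g x) a b = RInt f a b + RInt g a b.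
Proof. exact (RInt_plus f g a b). Qed.

Lemma RInt_sub (f g : R -> R) (a b : R) : ex_RInt f a b -> ex_RInt g a b ->
  RInt (fun x => f x - g x) a b = RInt f a b - RInt g a b.
Proof. exact (RInt_minus f g a b). Qed.

Lemma RInt_mul_l (f : R -> R) (k a b : R) : ex_RInt f a b ->
  RInt (fun x => k * f x) a b = k * RInt f a b.
Proof. exact (RInt_scal f a b k). Qed.

Lemma ex_RInt_add (f g : R -> R) (a b : R) : ex_RInt f a b -> ex_RInt g a b ->
  ex_RInt (fun x => f x + g x) a b.
Proof. exact (ex_RInt_plus f g a b). Qed.

Lemma ex_RInt_mul_l (f : R -> R) (k a b : R) : ex_RInt f a b ->
  ex_RInt (fun x => k * f x) a b.
Proof. exact (ex_RInt_scal f a b k). Qed.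

Lemma RInt_split (f : R -> R) (a b c : R) : ex_RInt f a b -> ex_RInt f b c ->
  RInt f a c = RInt f a b + RInt f b c.
Proof. intros H1 H2; symmetry; exact (RInt_Chasles f a b c H1 H2). Qed.

Lemma RInt_FTC (F f : R -> R) (a b : R) :
  (forall x, Rmin a b <= x <= Rmax a b -> is_derive F x (f x)) ->
  (forall x, Rmin a b <= x <= Rmax a b -> continuous f x) ->
  RInt f a b = F b - F a.
Proof.
  intros H1 H2; apply is_RInt_unique; exact (is_RInt_derive F f a b H1 H2).
Qed.

Lemma RInt_le_cont (f g : R -> R) (a b : R) : a <= b -> cont f -> cont g ->
  (forall x, a <= x <= b -> f x <= g x) -> RInt f a b <= RInt g a b.
Proof.
  intros Hab Hf Hg H; apply RInt_le; auto using cont_ex_RInt.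
  intros x Hx; apply H; lra.
Qed.

(** * Improper integrals over the half-line *)

Lemma monotone_is_lim (F : R -> R) (M : R) :
  (forall a b, 0 <= a <= b -> F a <= F b) -> (forall b, 0 <= b -> F b <= M) ->
  exists l : R, is_lim F p_infty l /\ l <= M /\ forall b, 0 <= b -> F b <= l.
Proof.
  intros Hm HM.
  destruct (completeness (fun y => exists b, 0 <= b /\ y = F b)) as [l [Hl1 Hl2]].
  - exists M; intros y (b & Hb & ->); auto.
  - exists (F 0), 0; split; auto; lra.
  - assert (Hub : forall b, 0 <= b -> F b <= l) by (intros b Hb; apply Hl1; exists b; auto).
    exists l; split; [|split; auto].
    + apply is_lim_spec; intros eps; simpl.
      destruct (Classical_Prop.classic (exists b, 0 <= b /\ l - eps < F b)) as [(b & Hb & Hlt)|Hn].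
      * exists b; intros x Hx.
        assert (F b <= F x) by (apply Hm; lra).
        assert (F x <= l) by (apply Hub; lra).
        apply Rabs_def1; destruct eps as [e He]; simpl in *; lra.
      * exfalso; assert (l <= l - eps); [|destruct eps as [e He]; simpl in *; lra].
        apply Hl2; intros y (b & Hb & ->).
        destruct (Rle_dec (F b) (l - eps)); auto; exfalso; apply Hn; exists b; split; lra.
    + apply Hl2; intros y (b & Hb & ->); auto.
Qed.

(** The lower endpoint is an ordinary one: integrands are made continuous at [0] before this notion
    is applied to them. *)
Definition improper (f : R -> R) (l : R) : Prop :=
  is_lim (fun b => RInt f 0 b) p_infty l.

(** A total value, meaningful once [improper f l] holds for some [l]. It lets an integral be named
    as a function of its parameters before its convergence is proved. *)
Definition improper_value (f : R -> R) : R := real (Lim (fun b => RInt f 0 b) p_infty).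

Lemma improper_value_eq (f : R -> R) (l : R) : improper f l -> improper_value f = l.
Proof. intros H; unfold improper_value; rewrite (is_lim_unique _ _ _ H); reflexivity. Qed.

Lemma Rbar_locally_pinf_pos (P : R -> Prop) :
  (forall x, 0 < x -> P x) -> Rbar_locally' p_infty P.
Proof. intros H; exists 0; auto. Qed.

Lemma improper_ext (f g : R -> R) (l : R) :
  (forall x, 0 < x -> f x = g x) -> improper f l -> improper g l.
Proof.
  intros H; apply is_lim_ext_loc, Rbar_locally_pinf_pos; intros b Hb.
  apply RInt_ext; intros x Hx; apply H; rewrite Rmin_left in Hx; lra.
Qed.

Lemma improper_add (f g : R -> R) (lf lg : R) : cont f -> cont g ->
  improper f lf -> improper g lg -> improper (fun x => f x + g x) (lf + lg).
Proof.
  intros Cf Cg Hf Hg; unfold improper.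
  apply is_lim_ext with (fun b => RInt f 0 b + RInt g 0 b).
  - intros b; rewrite RInt_add; auto using cont_ex_RInt.
  - apply is_lim_plus'; auto.
Qed.

Lemma improper_mul_l (k : R) (f : R -> R) (l : R) : cont f ->
  improper f l -> improper (fun x => k * f x) (k * l).
Proof.
  intros Cf Hf; unfold improper.
  apply is_lim_ext with (fun b => k * RInt f 0 b).
  - intros b; rewrite RInt_mul_l; auto using cont_ex_RInt.
  - exact (is_lim_scal_l _ k _ _ Hf).
Qed.

Lemma improper_le (f g : R -> R) (lf lg : R) : cont f -> cont g ->
  (forall x, 0 <= x -> f x <= g x) -> improper f lf -> improper g lg -> lf <= lg.
Proof.
  intros Cf Cg H Hf Hg.
  apply (is_lim_le_loc _ _ p_infty lf lg) with (2 := Hf) (3 := Hg).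
  apply Rbar_locally_pinf_pos; intros b Hb; apply RInt_le_cont; auto; try lra.
  intros x Hx; apply H; lra.
Qed.

Lemma RInt_mono_upper (f : R -> R) : cont f -> (forall x, 0 <= x -> 0 <= f x) ->
  forall a b, 0 <= a <= b -> RInt f 0 a <= RInt f 0 b.
Proof.
  intros Cf H a b Hab; rewrite (RInt_split f 0 a b); auto using cont_ex_RInt.
  assert (0 <= RInt f a b); [|lra].
  apply RInt_ge_0; auto using cont_ex_RInt; try lra; intros x Hx; apply H; lra.
Qed.

Lemma improper_upper (f : R -> R) (l : R) : cont f -> (forall x, 0 <= x -> 0 <= f x) ->
  improper f l -> forall b, 0 <= b -> RInt f 0 b <= l.
Proof.
  intros Cf H Hl b Hb.
  apply (is_lim_le_loc (fun _ => RInt f 0 b) _ p_infty (RInt f 0 b) l) with (3 := Hl).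
  - exists b; intros y Hy; apply RInt_mono_upper; auto; lra.
  - apply is_lim_const.
Qed.

Lemma improper_bounded (f : R -> R) (M : R) : cont f ->
  (forall x, 0 <= x -> 0 <= f x) -> (forall b, 0 <= b -> RInt f 0 b <= M) ->
  improper f (improper_value f) /\ 0 <= improper_value f <= M.
Proof.
  intros Cf H HM.
  destruct (monotone_is_lim (fun b => RInt f 0 b) M) as (l & Hl & HlM & Hb); auto.
  - apply RInt_mono_upper; auto.
  - rewrite (improper_value_eq f l Hl); repeat split; auto.
    specialize (Hb 0 (Rle_refl 0)); rewrite RInt_point in Hb; exact Hb.
Qed.

Lemma improper_dominated (f g : R -> R) (l : R) : cont f -> cont g ->
  (forall x, 0 <= x -> 0 <= f x <= g x) -> improper g l ->
  improper f (improper_value f) /\ 0 <= improper_value f <= l.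
Proof.
  intros Cf Cg H Hg; apply improper_bounded; auto.
  - intros x Hx; apply H; auto.
  - intros b Hb; apply Rle_trans with (RInt g 0 b).
    + apply RInt_le_cont; auto; intros x Hx; apply H; lra.
    + apply improper_upper; auto; intros x Hx; specialize (H x Hx); lra.
Qed.

(** * Series dominated by a convergent series *)

Lemma ex_series_dominated (u c : nat -> R) :
  (forall n, Rabs (u n) <= c n) -> ex_series c -> ex_series u.
Proof. intros H Hc; apply (ex_series_le u c); auto. Qed.

Lemma Series_ge_0 (u : nat -> R) : (forall n, 0 <= u n) -> ex_series u -> 0 <= Series u.
Proof.
  intros H Hu; replace 0 with (Series (fun n => 0 * u n)) by (rewrite Series_scal_l; ring).
  apply Series_le; auto; intros n; specialize (H n); lra.
Qed.

Lemma Series_tail (u : nat -> R) (M : nat) : ex_series u ->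
  Series u - sum_f_R0 u M = Series (fun k => u (S M + k)%nat).
Proof. intros H; rewrite (Series_incr_n u (S M)); [simpl pred; lra|lia|auto]. Qed.

Lemma Series_tail_bound (u c : nat -> R) (M : nat) :
  (forall n, Rabs (u n) <= c n) -> ex_series c ->
  Rabs (Series u - sum_f_R0 u M) <= Series c - sum_f_R0 c M.
Proof.
  intros H Hc.
  rewrite Series_tail by (eapply ex_series_dominated; eauto).
  rewrite (Series_tail c) by auto.
  assert (Hc' : ex_series (fun k => c (S M + k)%nat)) by (apply ex_series_incr_n; auto).
  assert (Hu' : ex_series (fun k => Rabs (u (S M + k)%nat))).
  { apply ex_series_dominated with (2 := Hc'); intros n; rewrite Rabs_Rabsolu; apply H. }
  eapply Rle_trans; [apply Series_Rabs; auto|].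
  apply Series_le; auto; intros n; split; [apply Rabs_pos|apply H].
Qed.

Lemma Series_tail_small (c : nat -> R) (eps : R) : ex_series c -> 0 < eps ->
  exists N, forall M, (N <= M)%nat -> Series c - sum_f_R0 c M < eps.
Proof.
  intros Hc He; apply Series_correct, is_series_Reals in Hc.
  destruct (Hc eps He) as [N HN]; exists N; intros M HM.
  specialize (HN M HM); unfold Rdist in HN; apply Rabs_def2 in HN; lra.
Qed.

Lemma is_series_mul_l (k : R) (u : nat -> R) (l : R) :
  is_series u l -> is_series (fun n => k * u n) (k * l).
Proof. exact (is_series_scal_l k u l). Qed.

Lemma is_series_eps (u : nat -> R) (l : R) :
  (forall eps, 0 < eps -> exists N, forall M, (N <= M)%nat -> Rabs (sum_f_R0 u M - l) < eps) ->
  is_series u l.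
Proof.
  intros H; apply is_series_Reals; intros eps He; destruct (H eps He) as [N HN].
  exists N; intros n Hn; apply HN; auto.
Qed.

Lemma continuous_eps (f : R -> R) (x : R) :
  (forall eps, 0 < eps -> locally x (fun y => Rabs (f y - f x) < eps)) -> continuous f x.
Proof.
  intros H; apply filterlim_locally; intros eps; apply (H eps), cond_pos.
Qed.

Lemma continuous_eps_inv (f : R -> R) (x eps : R) : continuous f x -> 0 < eps ->
  locally x (fun y => Rabs (f y - f x) < eps).
Proof.
  intros H He; exact (proj1 (filterlim_locally f (f x)) H (mkposreal eps He)).
Qed.

Lemma continuous_sum_f_R0 (f : nat -> R -> R) (M : nat) (x : R) :
  (forall n, continuous (f n) x) -> continuous (fun y => sum_f_R0 (fun n => f n y) M) x.
Proof.
  intros H; induction M; simpl; auto.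
  apply (continuous_plus (fun y => sum_f_R0 (fun n => f n y) M) (f (S M))); auto.
Qed.

(** Weierstrass test: a tail below [eps / 3] at both points leaves a finite sum to control. The
    bound is asked only near [x], because the theta series has no common bound down to [0]. *)
Lemma continuous_Series (f : nat -> R -> R) (c : nat -> R) (x : R) :
  locally x (fun y => forall n, Rabs (f n y) <= c n) -> ex_series c ->
  (forall n, continuous (f n) x) -> continuous (fun y => Series (fun n => f n y)) x.
Proof.
  intros Hb Hc Hf; apply continuous_eps; intros eps He.
  destruct (Series_tail_small c (eps / 3) Hc ltac:(lra)) as [M HM].
  specialize (HM M (le_n M)).
  pose proof (continuous_eps_inv _ x (eps / 3) (continuous_sum_f_R0 f M x Hf) ltac:(lra)) as HS.
  pose proof (locally_singleton _ _ Hb) as Hx.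
  generalize (filter_and _ _ Hb HS); apply filter_imp; intros y [H1 H2].
  pose proof (Series_tail_bound (fun n => f n y) c M H1 Hc) as T1.
  pose proof (Series_tail_bound (fun n => f n x) c M Hx Hc) as T2.
  apply Rabs_def2 in H2.
  apply Rabs_le_between in T1; apply Rabs_le_between in T2.
  apply Rabs_def1; lra.
Qed.

Lemma ex_RInt_sum_f_R0 (f : nat -> R -> R) (M : nat) (a b : R) :
  (forall n, ex_RInt (f n) a b) -> ex_RInt (fun y => sum_f_R0 (fun n => f n y) M) a b.
Proof.
  intros H; induction M; simpl; auto.
  apply (ex_RInt_plus (fun y => sum_f_R0 (fun n => f n y) M) (f (S M))); auto.
Qed.

Lemma RInt_sum_f_R0 (f : nat -> R -> R) (M : nat) (a b : R) :
  (forall n, ex_RInt (f n) a b) ->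
  RInt (fun y => sum_f_R0 (fun n => f n y) M) a b = sum_f_R0 (fun n => RInt (f n) a b) M.
Proof.
  intros H; induction M; simpl; auto.
  rewrite RInt_add; auto using ex_RInt_sum_f_R0; rewrite IHM; auto.
Qed.

Lemma is_series_RInt (f : nat -> R -> R) (c : nat -> R) (a b : R) : a <= b ->
  (forall n, ex_RInt (f n) a b) -> ex_RInt (fun x => Series (fun n => f n x)) a b ->
  (forall n x, a <= x <= b -> Rabs (f n x) <= c n) -> ex_series c ->
  is_series (fun n => RInt (f n) a b) (RInt (fun x => Series (fun n => f n x)) a b).
Proof.
  intros Hab Hf HS Hb Hc; apply is_series_eps; intros eps He.
  (* The [+ 1] keeps the denominator positive when [a = b]. *)
  assert (He' : 0 < eps / (b - a + 1)) by (apply Rdiv_lt_0_compat; lra).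
  destruct (Series_tail_small c _ Hc He') as [N HN]; exists N; intros M HM.
  specialize (HN M HM).
  rewrite <- RInt_sum_f_R0 by auto.
  rewrite <- RInt_sub by auto using ex_RInt_sum_f_R0.
  apply Rle_lt_trans with ((b - a) * (Series c - sum_f_R0 c M)).
  - apply abs_RInt_le_const; auto.
    + apply (ex_RInt_minus (fun y => sum_f_R0 (fun n => f n y) M)); auto using ex_RInt_sum_f_R0.
    + intros t Ht; rewrite Rabs_minus_sym; apply Series_tail_bound; auto.
  - apply Rle_lt_trans with ((b - a) * (eps / (b - a + 1))).
    + apply Rmult_le_compat_l; lra.
    + apply Rlt_le_trans with ((b - a + 1) * (eps / (b - a + 1))).
      * apply Rmult_lt_compat_r; lra.
      * right; field; lra.
Qed.

Lemma is_lim_eps (F : R -> R) (l : R) :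
  (forall eps, 0 < eps -> exists M, forall x, M < x -> Rabs (F x - l) < eps) -> is_lim F p_infty l.
Proof. intros H; apply is_lim_spec; intros eps; simpl; apply (H eps), cond_pos. Qed.

Lemma is_lim_eps_inv (F : R -> R) (l eps : R) : is_lim F p_infty l -> 0 < eps ->
  exists M, forall x, M < x -> Rabs (F x - l) < eps.
Proof. intros H He; apply is_lim_spec in H; exact (H (mkposreal eps He)). Qed.

Lemma filterlim_sum_f_R0 {T : Type} (Fl : (T -> Prop) -> Prop) {FF : Filter Fl}
  (F : nat -> T -> R) (l : nat -> R) (M : nat) :
  (forall n, filterlim (F n) Fl (locally (l n))) ->
  filterlim (fun x => sum_f_R0 (fun n => F n x) M) Fl (locally (sum_f_R0 l M)).
Proof.
  intros H; induction M; simpl; auto.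
  eapply filterlim_comp_2; [apply IHM|apply H|].
  apply (filterlim_plus (V := R_NormedModule)).
Qed.

(** Tannery's theorem, over an arbitrary filter so that it serves both for sequences and for limits
    at infinity. *)
Lemma filterlim_Series_dominated {T : Type} (Fl : (T -> Prop) -> Prop) {FF : Filter Fl}
  (F : nat -> T -> R) (l c : nat -> R) : ex_series c ->
  Fl (fun x => forall n, Rabs (F n x) <= c n) ->
  (forall n, filterlim (F n) Fl (locally (l n))) ->
  (forall n, Rabs (l n) <= c n) ->
  filterlim (fun x => Series (fun n => F n x)) Fl (locally (Series l)).
Proof.
  intros Hc Hb HF Hl; apply (filterlim_locally (F := Fl)); intros [eps He].
  destruct (Series_tail_small c (eps / 3) Hc ltac:(lra)) as [M HM].
  specialize (HM M (le_n M)).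
  assert (HK := proj1 (filterlim_locally (F := Fl) _ _)
    (filterlim_sum_f_R0 Fl F l M HF) (mkposreal (eps / 3) ltac:(lra))).
  generalize (filter_and _ _ HK Hb); apply filter_imp; intros x [H1 H2].
  change (Rabs (Series (fun n => F n x) - Series l) < eps).
  change (Rabs (sum_f_R0 (fun n => F n x) M - sum_f_R0 l M) < eps / 3) in H1.
  pose proof (Series_tail_bound (fun n => F n x) c M H2 Hc) as T1.
  pose proof (Series_tail_bound l c M Hl Hc) as T2.
  apply Rabs_le_between in T1; apply Rabs_le_between in T2; apply Rabs_def2 in H1.
  apply Rabs_def1; lra.
Qed.

(** Comparison with a telescoping series: [1 / n^2 <= 2 (1 / n - 1 / (n + 1))] because
    [n + 1 <= 2 n]. *)
Lemma ex_series_inv_sq : ex_series (fun n => / INR (S n) ^ 2).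
Proof.
  assert (Hp : forall n, 0 < INR (S n)) by (intros; apply lt_0_INR; lia).
  apply ex_series_dominated with (fun n => 2 * (/ INR (S n) - / INR (S (S n)))).
  - intros n; specialize (Hp n); rewrite (S_INR (S n)).
    rewrite Rabs_pos_eq by (left; apply Rinv_0_lt_compat, pow_lt; auto).
    assert (1 <= INR (S n)) by (apply (le_INR 1); lia).
    set (x := INR (S n)) in *.
    apply Rmult_le_reg_r with (x ^ 2 * (x + 1)); [apply Rmult_lt_0_compat; [apply pow_lt|]; lra|].
    replace (/ x ^ 2 * (x ^ 2 * (x + 1))) with (x + 1) by (field; lra).
    replace (2 * (/ x - / (x + 1)) * (x ^ 2 * (x + 1))) with (2 * x) by (field; lra).
    lra.
  - apply (ex_series_scal_l 2 (fun n => / INR (S n) - / INR (S (S n)))).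
    exists 1; apply is_series_eps; intros eps He.
    assert (Hs : forall M, sum_f_R0 (fun n => / INR (S n) - / INR (S (S n))) M
      = 1 - / INR (S (S M))).
    { induction M; [simpl; lra|rewrite tech5, IHM; ring]. }
    destruct (archimed_cor1 eps He) as (N & HN & HN0); exists N; intros M HM.
    rewrite Hs; replace (1 - / INR (S (S M)) - 1) with (- / INR (S (S M))) by ring.
    rewrite Rabs_Ropp, Rabs_pos_eq by (left; apply Rinv_0_lt_compat; auto).
    eapply Rle_lt_trans; [|exact HN].
    apply Rinv_le_contravar; [apply lt_0_INR; auto|apply le_INR; lia].
Qed.


(** * Gaussian moments *)

Definition gm (m : nat) (c x : R) : R := x ^ m * exp (- c * x ^ 2).

(** For [c > 0] this is [Gamma ((m + 1) / 2) / (2 c^((m + 1) / 2))]. Odd moments are explicit at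
    once; even ones stay relative to [mu 0 c], which only the theta functional equation
    evaluates. *)
Definition mu (m : nat) (c : R) : R := improper_value (gm m c).

Lemma is_derive_pow_id (m : nat) (x : R) :
  is_derive (fun y => y ^ S m) x (INR (S m) * x ^ m).
Proof. apply is_derive_Reals; exact (derivable_pt_lim_pow x (S m)). Qed.

Lemma cont_gm (m : nat) (c : R) : cont (gm m c).
Proof.
  intros x; apply (continuous_mult (fun y => y ^ m) (fun y => exp (- c * y ^ 2))).
  - apply ex_derive_cont; auto_derive; trivial.
  - apply ex_derive_cont; auto_derive; trivial.
Qed.

Lemma gm_ge_0 (m : nat) (c x : R) : 0 <= x -> 0 <= gm m c x.
Proof. intros H; apply Rmult_le_pos; [apply pow_le; auto|left; apply exp_pos]. Qed.

Lemma exp_INR_mul (n : nat) (z : R) : exp (INR n * z) = exp z ^ n.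
Proof.
  induction n; [rewrite Rmult_0_l; apply exp_0|].
  rewrite S_INR, Rmult_plus_distr_r, exp_plus, IHn, Rmult_1_l; simpl; ring.
Qed.

(** The inequality [1 + z <= exp z] at [z = y / n], raised to the [n]-th power. *)
Lemma pow_le_exp (n : nat) (y : R) : (1 <= n)%nat -> 0 <= y -> (y / INR n) ^ n <= exp y.
Proof.
  intros Hn Hy.
  assert (Hn' : 0 < INR n) by (apply lt_0_INR; lia).
  replace (exp y) with (exp (INR n * (y / INR n))) by (f_equal; field; lra).
  rewrite exp_INR_mul; apply pow_incr; split.
  - apply Rdiv_le_0_compat; lra.
  - pose proof (exp_ineq1_le (y / INR n)); lra.
Qed.

(** Applying [pow_le_exp] with exponent [m] to [c x^2] gives [exp (- c x^2) <= (m / c)^m / x^(2 m)];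
    then [x <= x^m] for [x >= 1]. *)
Lemma gm_le_inv (m : nat) (c x : R) : (1 <= m)%nat -> 0 < c -> 1 <= x ->
  gm m c x <= (INR m / c) ^ m / x.
Proof.
  intros Hm Hc Hx; unfold gm.
  assert (Hm' : 0 < INR m) by (apply lt_0_INR; lia).
  pose proof (pow_le_exp m (c * x ^ 2) Hm ltac:(nra)) as H.
  replace (- c * x ^ 2) with (- (c * x ^ 2)) by ring; rewrite exp_Ropp.
  assert (Hp : 0 < (c * x ^ 2 / INR m) ^ m).
  { apply pow_lt, Rdiv_lt_0_compat; auto; apply Rmult_lt_0_compat; auto; apply pow_lt; lra. }
  assert (Hx1 : 1 <= x ^ m) by (apply pow_R1_Rle; auto).
  assert (Hxm : x <= x ^ m).
  { destruct m; [lia|]; simpl. assert (1 <= x ^ m) by (apply pow_R1_Rle; auto). nra. }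
  apply Rle_trans with (x ^ m * / (c * x ^ 2 / INR m) ^ m).
  - apply Rmult_le_compat_l; [lra|apply Rinv_le_contravar; auto].
  - replace (x ^ m * / (c * x ^ 2 / INR m) ^ m) with ((INR m / c) ^ m * / x ^ m).
    + apply Rmult_le_compat_l.
      * apply pow_le, Rlt_le, Rdiv_lt_0_compat; auto.
      * apply Rinv_le_contravar; lra.
    + unfold Rdiv; rewrite !Rpow_mult_distr, !pow_inv, <- pow_mult.
      replace (x ^ (2 * m)) with (x ^ m * x ^ m) by (rewrite <- pow_add; f_equal; lia).
      field; repeat split; apply pow_nonzero; lra.
Qed.

Lemma is_lim_inv_pinf (C : R) : is_lim (fun x => C / x) p_infty 0.
Proof.
  apply is_lim_eps; intros eps He; exists (Rmax 1 (Rabs C / eps)); intros x Hx.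
  pose proof (Rmax_l 1 (Rabs C / eps)); pose proof (Rmax_r 1 (Rabs C / eps)).
  rewrite Rminus_0_r; unfold Rdiv; rewrite Rabs_mult, Rabs_inv, (Rabs_pos_eq x) by lra.
  apply Rmult_lt_reg_r with x; [lra|].
  replace (Rabs C * / x * x) with (Rabs C) by (field; lra).
  assert (Rabs C / eps * eps < x * eps) by (apply Rmult_lt_compat_r; lra).
  replace (Rabs C / eps * eps) with (Rabs C) in * by (field; lra); lra.
Qed.

Lemma is_lim_squeeze_0 (F G : R -> R) (M : R) :
  (forall x, M < x -> Rabs (F x) <= G x) -> is_lim G p_infty 0 -> is_lim F p_infty 0.
Proof.
  intros H HG; apply is_lim_eps; intros eps He.
  destruct (is_lim_eps_inv _ _ eps HG He) as [K HK]; exists (Rmax K M); intros x Hx.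
  pose proof (Rmax_l K M); pose proof (Rmax_r K M).
  specialize (H x ltac:(lra)); specialize (HK x ltac:(lra)).
  rewrite Rminus_0_r in *; apply Rabs_def2 in HK; lra.
Qed.

Lemma is_lim_gm (m : nat) (c : R) : (1 <= m)%nat -> 0 < c -> is_lim (gm m c) p_infty 0.
Proof.
  intros Hm Hc; apply is_lim_squeeze_0 with (fun x => (INR m / c) ^ m / x) 1.
  - intros x Hx; rewrite Rabs_pos_eq by (apply gm_ge_0; lra); apply gm_le_inv; auto; lra.
  - apply is_lim_inv_pinf.
Qed.

Lemma improper_gm_0 (c : R) : 0 < c -> improper (gm 0 c) (mu 0 c).
Proof.
  intros Hc; apply (improper_bounded (gm 0 c) (exp (c / 4) / c)).
  - apply cont_gm.
  - intros; apply gm_ge_0; auto.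
  (* The majorant comes from [c (x - 1 / 2)^2 >= 0] and has an elementary primitive. *)
  - intros b Hb; apply Rle_trans with (RInt (fun x => exp (c / 4 - c * x)) 0 b).
    + apply RInt_le_cont; auto; [apply cont_gm| |].
      * intros x; apply ex_derive_cont; auto_derive; trivial.
      * intros x _; unfold gm; rewrite Rmult_1_l.
        apply exp_le_exp.
        assert (0 <= c * (x - 1 / 2) ^ 2) by (apply Rmult_le_pos; [lra|apply pow2_ge_0]).
        lra.
    + rewrite (RInt_FTC (fun x => - exp (c / 4 - c * x) / c)).
      * assert (0 < exp (c / 4 - c * b) / c) by (apply Rdiv_lt_0_compat; auto; apply exp_pos).
        replace (c / 4 - c * 0) with (c / 4) by ring; lra.
      * intros x _; auto_derive; [trivial|]. unfold Rminus, Rdiv; field; lra.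
      * intros x _; apply ex_derive_cont; auto_derive; trivial.
Qed.

Lemma improper_gm_1 (c : R) : 0 < c -> improper (gm 1 c) (/ (2 * c)).
Proof.
  intros Hc; unfold improper.
  apply is_lim_ext with (fun b => / (2 * c) - gm 0 c b / (2 * c)).
  - intros b; rewrite (RInt_FTC (fun x => - exp (- c * x ^ 2) / (2 * c))).
    + unfold gm; replace (- c * 0 ^ 2) with 0 by ring; rewrite exp_0; simpl; field; lra.
    + intros x _; unfold gm; auto_derive; [trivial|]; simpl; field; lra.
    + intros; apply cont_gm.
  - replace (Finite (/ (2 * c))) with (Finite (/ (2 * c) + 0)) by (f_equal; ring).
    apply is_lim_plus'; [apply is_lim_const|].
    apply is_lim_squeeze_0 with (fun x => gm 1 c x / (2 * c)) 1.
    + intros x Hx; rewrite Rabs_Ropp, Rabs_pos_eq.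
      * unfold Rdiv; apply Rmult_le_compat_r; [left; apply Rinv_0_lt_compat; lra|].
        unfold gm; simpl; pose proof (exp_pos (- c * (x * (x * 1)))); nra.
      * apply Rdiv_le_0_compat; [apply gm_ge_0|]; lra.
    + apply is_lim_ext with (fun x => / (2 * c) * gm 1 c x); [intros; field; lra|].
      pose proof (is_lim_scal_l _ (/ (2 * c)) _ _ (is_lim_gm 1 c (le_n 1) Hc)) as H.
      simpl in H; rewrite Rmult_0_r in H; exact H.
Qed.

(** Integration by parts, with [x^(m + 1) exp (- c x^2) / (2 c)] as the primitive. *)
Lemma RInt_gm_SS (m : nat) (c b : R) : 0 < c ->
  RInt (gm (S (S m)) c) 0 b = INR (S m) / (2 * c) * RInt (gm m c) 0 b - gm (S m) c b / (2 * c).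
Proof.
  intros Hc.
  assert (H : RInt (fun x => INR (S m) / (2 * c) * gm m c x + -1 * gm (S (S m)) c x) 0 b
     = gm (S m) c b / (2 * c) - gm (S m) c 0 / (2 * c)).
  { apply (RInt_FTC (fun x => gm (S m) c x / (2 * c))).
    - intros x _.
      eapply is_derive_eq.
      + apply (is_derive_ext (fun y => / (2 * c) * (y ^ S m * exp (- c * y ^ 2)))).
        * intros y; unfold gm; eqR; field; lra.
        * apply is_derive_scal.
          apply (is_derive_mult (fun y => y ^ S m) (fun y => exp (- c * y ^ 2)) x).
          -- apply is_derive_pow_id.
          -- auto_derive; [trivial|]; reflexivity.
          -- intros; apply Rmult_comm.
      + unfold gm, plus, mult; cbn -[INR pow]; simpl (x ^ S (S m)); simpl (x ^ S m); simpl (x ^ 2);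
        simpl (x ^ 1); field; lra.
    - intros x _; apply cont_add; intros y; apply (cont_mul (fun _ => _)); try apply cont_gm;
      intros z; apply continuous_const. }
  rewrite RInt_add, !RInt_mul_l in H; auto using cont_ex_RInt, cont_gm, ex_RInt_mul_l.
  replace (gm (S m) c 0) with 0 in H by (unfold gm; simpl; ring).
  lra.
Qed.

Lemma improper_gm_SS (m : nat) (c l : R) : 0 < c -> improper (gm m c) l ->
  improper (gm (S (S m)) c) (INR (S m) / (2 * c) * l).
Proof.
  intros Hc Hl; unfold improper.
  apply is_lim_ext with
    (fun b => INR (S m) / (2 * c) * RInt (gm m c) 0 b + (- / (2 * c)) * gm (S m) c b).
  - intros b; rewrite RInt_gm_SS by auto; field; lra.
  - replace (Finite (INR (S m) / (2 * c) * l))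
      with (Finite (INR (S m) / (2 * c) * l + (- / (2 * c)) * 0)) by (f_equal; ring).
    apply is_lim_plus'.
    + exact (is_lim_scal_l _ (INR (S m) / (2 * c)) _ _ Hl).
    + exact (is_lim_scal_l _ (- / (2 * c)) _ _ (is_lim_gm (S m) c ltac:(lia) Hc)).
Qed.

Lemma improper_gm (m : nat) (c : R) : 0 < c -> improper (gm m c) (mu m c).
Proof.
  intros Hc.
  (* The recurrence lowers the exponent by two, so the induction carries two consecutive moments. *)
  enough (improper (gm m c) (mu m c) /\ improper (gm (S m) c) (mu (S m) c)) by tauto.
  induction m as [|m [IH1 IH2]].
  - split; [apply improper_gm_0; auto|].
    unfold mu; rewrite (improper_value_eq _ _ (improper_gm_1 c Hc)); apply improper_gm_1; auto.
  - split; auto.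
    pose proof (improper_gm_SS m c _ Hc IH1) as H.
    unfold mu at 1; rewrite (improper_value_eq _ _ H); exact H.
Qed.

Lemma mu_SS (m : nat) (c : R) : 0 < c -> mu (S (S m)) c = INR (S m) / (2 * c) * mu m c.
Proof. intros Hc; apply improper_value_eq, improper_gm_SS, improper_gm; auto. Qed.

Lemma mu_1 (c : R) : 0 < c -> mu 1 c = / (2 * c).
Proof. intros Hc; apply improper_value_eq, improper_gm_1; auto. Qed.

Lemma mu_scale (c : R) : 0 < c -> mu 0 c = mu 0 1 / sqrt c.
Proof.
  intros Hc; assert (Hs : 0 < sqrt c) by (apply sqrt_lt_R0; auto).
  apply improper_value_eq; unfold improper.
  apply is_lim_ext with (fun b => / sqrt c * RInt (gm 0 1) 0 (sqrt c * b + 0)).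
  - intros b.
    replace (RInt (gm 0 1) 0 (sqrt c * b + 0))
      with (RInt (gm 0 1) (sqrt c * 0 + 0) (sqrt c * b + 0)) by (f_equal; ring).
    rewrite <- (RInt_comp_lin (gm 0 1) (sqrt c) 0 0 b) by (apply cont_ex_RInt, cont_gm).
    rewrite <- RInt_mul_l.
    + apply RInt_ext; intros x _; unfold gm, scal; cbn -[pow].
      unfold mult; simpl.
      replace (- (1) * ((sqrt c * x + 0) * ((sqrt c * x + 0) * 1))) with (- ((sqrt c * sqrt c) * x * x)) by ring.
      rewrite sqrt_sqrt by lra.
      replace (- c * (x * (x * 1))) with (- (c * x * x)) by ring; field; lra.
    + apply (ex_RInt_comp_lin (gm 0 1)), cont_ex_RInt, cont_gm.
  - unfold Rdiv; rewrite Rmult_comm.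
    apply (is_lim_scal_l _ (/ sqrt c) p_infty (mu 0 1)).
    apply (is_lim_comp_lin (fun b => RInt (gm 0 1) 0 b)); [|lra].
    replace (Rbar_plus (Rbar_mult (sqrt c) p_infty) 0) with p_infty.
    + apply improper_gm; lra.
    + rewrite (Rbar_mult_comm _ p_infty), (is_Rbar_mult_unique p_infty (sqrt c) p_infty); auto.
      apply is_Rbar_mult_p_infty_pos; auto.
Qed.


(** * Pointwise convergence of Fourier series *)

(** The Dirichlet kernel of order [S M]: [sum_f_R0] up to [M] has [S M] terms. *)
Definition dirichlet (M : nat) (u : R) : R :=
  1 + 2 * sum_f_R0 (fun n => cos (2 * PI * INR (S n) * u)) M.

(** Telescoping, from [2 sin A cos B = sin (B + A) - sin (B - A)]. *)
Lemma sin_mul_dirichlet (M : nat) (u : R) :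
  sin (PI * u) * dirichlet M u = sin ((2 * INR (S M) + 1) * PI * u).
Proof.
  unfold dirichlet; induction M.
  - cbn [sum_f_R0 INR].
    replace ((2 * 1 + 1) * PI * u) with (2 * (PI * u) + PI * u) by ring.
    replace (2 * PI * 1 * u) with (2 * (PI * u)) by ring.
    rewrite sin_plus, cos_2a_sin, sin_2a.
    pose proof (sin2_cos2 (PI * u)) as H; unfold Rsqr in H.
    replace (2 * sin (PI * u) * cos (PI * u) * cos (PI * u))
      with (2 * sin (PI * u) * (1 - sin (PI * u) * sin (PI * u))) by (rewrite <- H; ring).
    ring.
  - rewrite tech5, (S_INR (S M)).
    set (S0 := sum_f_R0 _ _) in *.
    replace (sin (PI * u) * (1 + 2 * (S0 + cos (2 * PI * (INR (S M) + 1) * u))))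
      with (sin (PI * u) * (1 + 2 * S0)
            + 2 * sin (PI * u) * cos (2 * PI * (INR (S M) + 1) * u)) by ring.
    rewrite IHM.
    replace ((2 * INR (S M) + 1) * PI * u)
      with (2 * PI * (INR (S M) + 1) * u - PI * u) by ring.
    replace ((2 * (INR (S M) + 1) + 1) * PI * u)
      with (2 * PI * (INR (S M) + 1) * u + PI * u) by ring.
    rewrite sin_plus, sin_minus; ring.
Qed.

Lemma cont_cos_lin (w : R) : cont (fun u => cos (w * u)).
Proof. intros x; apply ex_derive_cont; auto_derive; trivial. Qed.

Lemma cont_sin_lin (w : R) : cont (fun u => sin (w * u)).
Proof. intros x; apply ex_derive_cont; auto_derive; trivial. Qed.

Lemma cont_const (k : R) : cont (fun _ => k).
Proof. intros x; apply continuous_const. Qed.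

Lemma cont_dirichlet (M : nat) : cont (dirichlet M).
Proof.
  apply cont_add; [apply cont_const|]; apply cont_mul; [apply cont_const|].
  intros x; apply (continuous_sum_f_R0 (fun n u => cos (2 * PI * INR (S n) * u))).
  intros n; apply cont_cos_lin.
Qed.

Lemma Rabs_RInt_le (f : R -> R) (a b K : R) : a <= b -> ex_RInt f a b ->
  (forall x, a <= x <= b -> Rabs (f x) <= K) -> Rabs (RInt f a b) <= (b - a) * K.
Proof. intros; apply abs_RInt_le_const; auto. Qed.

Lemma continuous_bounded (f : R -> R) (a b : R) : a <= b ->
  (forall x, a <= x <= b -> continuous f x) ->
  exists K, 0 <= K /\ forall x, a <= x <= b -> Rabs (f x) <= K.
Proof.
  intros Hab Hf.
  destruct (continuity_ab_maj (fun x => Rabs (f x)) a b Hab) as (x0 & H0 & H1).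
  - intros c Hc; apply continuity_pt_filterlim.
    apply (continuous_comp f Rabs); [apply Hf; auto|apply continuous_Rabs].
  - exists (Rabs (f x0)); split; [apply Rabs_pos|auto].
Qed.

(** One integration by parts gains the factor [/ w]. In [K], the term [2 * K0] pays for the two
    boundary values and [(b - a) * K1] for the remaining integral. *)
Lemma riemann_lebesgue_C1 (h dh : R -> R) (a b : R) : a <= b ->
  (forall x, a <= x <= b -> is_derive h x (dh x)) ->
  (forall x, a <= x <= b -> continuous dh x) ->
  exists K, forall w, 0 < w -> Rabs (RInt (fun u => h u * sin (w * u)) a b) <= K / w.
Proof.
  intros Hab Hh Hdh.
  assert (Ch : forall x, a <= x <= b -> continuous h x).
  { intros x Hx; apply ex_derive_cont; exists (dh x); auto. }
  destruct (continuous_bounded h a b Hab Ch) as (K0 & HK0 & HK0').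
  destruct (continuous_bounded dh a b Hab Hdh) as (K1 & HK1 & HK1').
  exists (2 * K0 + (b - a) * K1); intros w Hw.
  assert (Hin : forall x, Rmin a b <= x <= Rmax a b -> a <= x <= b).
  { intros x; rewrite Rmin_left, Rmax_right by auto; auto. }
  assert (C1 : ex_RInt (fun u => dh u * cos (w * u)) a b).
  { apply (ex_RInt_continuous (fun u => dh u * cos (w * u))); intros x Hx.
    apply (continuous_mult dh (fun u => cos (w * u))); auto; apply cont_cos_lin. }
  assert (C2 : ex_RInt (fun u => h u * sin (w * u)) a b).
  { apply (ex_RInt_continuous (fun u => h u * sin (w * u))); intros x Hx.
    apply (continuous_mult h (fun u => sin (w * u))); auto; apply cont_sin_lin. }
  assert (H : RInt (fun u => / w * (dh u * cos (w * u)) + - 1 * (h u * sin (w * u))) a b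
    = h b * (cos (w * b) / w) - h a * (cos (w * a) / w)).
  { apply (RInt_FTC (fun u => h u * (cos (w * u) / w))).
    - intros x Hx; eapply is_derive_eq.
      + apply (is_derive_mult h (fun u => cos (w * u) / w) x (dh x)).
        * auto.
        * auto_derive; [trivial|reflexivity].
        * intros; apply Rmult_comm.
      + unfold plus, mult; simpl; field; lra.
    - intros x Hx.
      apply (continuous_plus (fun u => / w * (dh u * cos (w * u)))
               (fun u => - 1 * (h u * sin (w * u)))).
      + apply (continuous_mult (fun _ => / w)); [apply continuous_const|].
        apply (continuous_mult dh (fun u => cos (w * u))); auto; apply cont_cos_lin.
      + apply (continuous_mult (fun _ => - 1)); [apply continuous_const|].
        apply (continuous_mult h (fun u => sin (w * u))); auto; apply cont_sin_lin. }
  rewrite RInt_add, !RInt_mul_l in H; auto using ex_RInt_mul_l.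
  assert (B1 : Rabs (RInt (fun u => dh u * cos (w * u)) a b) <= (b - a) * K1).
  { apply Rabs_RInt_le; auto; intros x Hx; rewrite Rabs_mult.
    rewrite <- (Rmult_1_r K1); apply Rmult_le_compat; auto using Rabs_pos.
    apply Rabs_le, COS_bound. }
  assert (B2 : forall x, a <= x <= b -> Rabs (h x * (cos (w * x) / w)) <= K0 / w).
  { intros x Hx; unfold Rdiv; rewrite !Rabs_mult, (Rabs_pos_eq (/ w))
      by (left; apply Rinv_0_lt_compat; auto).
    rewrite <- Rmult_assoc; apply Rmult_le_compat_r; [left; apply Rinv_0_lt_compat; auto|].
    rewrite <- (Rmult_1_r K0); apply Rmult_le_compat; auto using Rabs_pos.
    apply Rabs_le, COS_bound. }
  replace (RInt (fun u => h u * sin (w * u)) a b) with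
    (/ w * RInt (fun u => dh u * cos (w * u)) a b - h b * (cos (w * b) / w)
       + h a * (cos (w * a) / w)) by lra.
  replace ((2 * K0 + (b - a) * K1) / w) with (/ w * ((b - a) * K1) + K0 / w + K0 / w)
    by (field; lra).
  eapply Rle_trans; [apply Rabs_triang|]; apply Rplus_le_compat; [|apply B2; lra].
  eapply Rle_trans; [apply Rabs_triang|]; rewrite Rabs_Ropp.
  apply Rplus_le_compat; [|apply B2; lra].
  rewrite Rabs_mult, (Rabs_pos_eq (/ w)) by (left; apply Rinv_0_lt_compat; auto).
  apply Rmult_le_compat_l; auto; left; apply Rinv_0_lt_compat; auto.
Qed.

(** Mean value theorem: the cosine is at least [1 / 2] up to [PI / 3], hence on [[0, PI / 4]], and
    [PI / 2 >= 1]. *)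
Lemma sin_PI_mul_ge (u : R) : 0 <= u <= 1 / 4 -> u <= sin (PI * u).
Proof.
  intros Hu; pose proof PI2_1; pose proof PI_4.
  set (x := PI * u).
  assert (Hx : 0 <= x <= PI / 4) by (unfold x; split; nra).
  enough (x / 2 <= sin x) by (unfold x in *; nra).
  destruct (MVT_cor4 sin cos 0 (mkposreal PI PI_RGT_0)) with (b := x) as (c & Hc & Hc').
  - intros c _; apply is_derive_Reals, derivable_pt_lim_sin.
  - simpl; rewrite Rminus_0_r, Rabs_pos_eq; lra.
  - rewrite sin_0, !Rminus_0_r, (Rabs_pos_eq x) in *; try lra.
    rewrite Hc.
    assert (Hc2 : 1 / 2 <= cos (Rabs c)).
    { rewrite <- cos_PI3; apply cos_decr_1; try lra; apply Rabs_pos. }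
    assert (cos (Rabs c) = cos c) by (unfold Rabs; destruct (Rcase_abs c); auto using cos_neg).
    nra.
Qed.

(** The point is uniformity in [M]: the peak of the kernel at [0] is compensated by any factor of
    size [O(u)], such as a Lipschitz function vanishing there. *)
Lemma dirichlet_bound_0 (M : nat) (u : R) : 0 <= u <= 1 / 4 -> u * Rabs (dirichlet M u) <= 1.
Proof.
  intros Hu; pose proof (sin_PI_mul_ge u Hu) as Hs.
  apply Rle_trans with (Rabs (sin (PI * u) * dirichlet M u)).
  - rewrite Rabs_mult; apply Rmult_le_compat_r; [apply Rabs_pos|].
    rewrite Rabs_pos_eq; lra.
  - rewrite sin_mul_dirichlet; apply Rabs_le, SIN_bound.
Qed.

Lemma cos_2PI_INR_sub (n : nat) (u : R) :
  cos (2 * PI * INR n * (1 - u)) = cos (2 * PI * INR n * u).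
Proof.
  replace (2 * PI * INR n * (1 - u)) with (- (2 * PI * INR n * u) + 2 * INR n * PI) by ring.
  rewrite cos_period; apply cos_neg.
Qed.

Lemma dirichlet_sub (M : nat) (u : R) : dirichlet M (1 - u) = dirichlet M u.
Proof.
  unfold dirichlet; do 2 f_equal; apply sum_eq; intros; apply cos_2PI_INR_sub.
Qed.

(** Near the two ends the integrand is bounded by a Lipschitz constant of [f], uniformly in [M], so
    short end intervals contribute little. Between them [f u / sin (PI * u)] is continuously
    differentiable, and Riemann-Lebesgue applies. *)
Lemma RInt_dirichlet_0 (f df : R -> R) :
  (forall x, is_derive f x (df x)) -> cont df -> f 0 = 0 -> f 1 = 0 ->
  forall eps, 0 < eps -> exists N, forall M, (N <= M)%nat ->
    Rabs (RInt (fun u => f u * dirichlet M u) 0 1) < eps.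
Proof.
  intros Hf Hdf F0 F1 eps He.
  assert (Cf : cont f) by (intros x; apply ex_derive_cont; exists (df x); auto).
  destruct (continuous_bounded df 0 1 ltac:(lra)) as (L & HL & HL'); [auto|].
  assert (Lip : forall x y, 0 <= x <= 1 -> 0 <= y <= 1 -> Rabs (f y - f x) <= L * Rabs (y - x)).
  { intros x y Hx Hy.
    destruct (MVT_gen f x y df) as (c & Hc & ->).
    - intros; apply Hf.
    - intros; apply continuity_pt_filterlim, Cf.
    - rewrite Rabs_mult; apply Rmult_le_compat_r; [apply Rabs_pos|apply HL'].
      revert Hc; unfold Rmin, Rmax; destruct (Rle_dec x y); lra. }
  assert (Cfd : forall M, cont (fun u => f u * dirichlet M u)).
  { intros M; apply cont_mul; auto using cont_dirichlet. }
  assert (B0 : forall M u, 0 <= u <= 1 / 4 -> Rabs (f u * dirichlet M u) <= L).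
  { intros M u Hu; rewrite Rabs_mult.
    specialize (Lip 0 u ltac:(lra) ltac:(lra)); rewrite F0, !Rminus_0_r, (Rabs_pos_eq u) in Lip by lra.
    pose proof (dirichlet_bound_0 M u Hu); pose proof (Rabs_pos (dirichlet M u)).
    apply Rle_trans with (L * u * Rabs (dirichlet M u)).
    - apply Rmult_le_compat_r; auto.
    - rewrite Rmult_assoc, <- (Rmult_1_r L) at 1; rewrite Rmult_1_r; nra. }
  assert (B1 : forall M u, 3 / 4 <= u <= 1 -> Rabs (f u * dirichlet M u) <= L).
  { intros M u Hu; rewrite Rabs_mult, <- dirichlet_sub.
    specialize (Lip 1 u ltac:(lra) ltac:(lra)).
    rewrite F1, Rminus_0_r, (Rabs_minus_sym u 1), (Rabs_pos_eq (1 - u)) in Lip by lra.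
    pose proof (dirichlet_bound_0 M (1 - u) ltac:(lra)).
    pose proof (Rabs_pos (dirichlet M (1 - u))).
    apply Rle_trans with (L * (1 - u) * Rabs (dirichlet M (1 - u))).
    - apply Rmult_le_compat_r; auto.
    - nra. }
  (* [1 / 4] keeps the end intervals in the range of the kernel bound; the other term makes each of
     them contribute at most [eps / 4], with [L + 1] to avoid a zero denominator. *)
  set (d := Rmin (1 / 4) (eps / (4 * (L + 1)))).
  assert (Hd : 0 < d <= 1 / 4).
  { split; [|apply Rmin_l]; apply Rmin_glb_lt; [lra|apply Rdiv_lt_0_compat; lra]. }
  assert (HdL : d * L <= eps / 4).
  { apply Rle_trans with (eps / (4 * (L + 1)) * (L + 1)).
    - apply Rmult_le_compat; try lra; apply Rmin_r.
    - right; field; lra. }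
  assert (Hsin : forall x, d <= x <= 1 - d -> sin (PI * x) <> 0).
  { intros x Hx; apply Rgt_not_eq, sin_gt_0; pose proof PI_RGT_0; nra. }
  destruct (riemann_lebesgue_C1 (fun u => f u / sin (PI * u))
    (fun u => (df u * sin (PI * u) - f u * (PI * cos (PI * u))) / (sin (PI * u)) ^ 2)
    d (1 - d)) as [K HK]; try lra.
  - intros x Hx; specialize (Hsin x Hx).
    apply (is_derive_div f (fun u => sin (PI * u)) x (df x) (PI * cos (PI * x))); auto.
    auto_derive; [trivial|ring].
  - intros x Hx; specialize (Hsin x Hx).
    apply (continuous_mult (fun u => df u * sin (PI * u) - f u * (PI * cos (PI * u)))
             (fun u => / sin (PI * u) ^ 2)).
    + apply (continuous_minus (fun u => df u * sin (PI * u)) (fun u => f u * (PI * cos (PI * u)))).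
      * apply cont_mul; auto using cont_sin_lin.
      * apply cont_mul; auto; apply cont_mul; auto using cont_cos_lin, cont_const.
    + apply ex_derive_cont; auto_derive; exact (pow_nonzero _ 2 Hsin).
  (* The frequency [(2 * INR (S M) + 1) * PI] exceeds [N], so the middle part is at most [eps / 4]
     as well. *)
  - destruct (archimed_cor1 (eps / (4 * (Rabs K + 1)))) as (N & HN & HN0).
    { apply Rdiv_lt_0_compat; auto; pose proof (Rabs_pos K); lra. }
    exists N; intros M HM.
    rewrite (RInt_split _ 0 d 1), (RInt_split _ d (1 - d) 1) by auto using cont_ex_RInt.
    assert (I0 : Rabs (RInt (fun u => f u * dirichlet M u) 0 d) <= (d - 0) * L).
    { apply Rabs_RInt_le; auto using cont_ex_RInt; try lra; intros; apply B0; lra. }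
    assert (I1 : Rabs (RInt (fun u => f u * dirichlet M u) (1 - d) 1) <= (1 - (1 - d)) * L).
    { apply Rabs_RInt_le; auto using cont_ex_RInt; try lra; intros; apply B1; lra. }
    assert (I2 : Rabs (RInt (fun u => f u * dirichlet M u) d (1 - d)) <= eps / 4).
    { set (w := (2 * INR (S M) + 1) * PI).
      assert (HNM : INR N <= INR M) by (apply le_INR; auto).
      assert (HN1 : 0 < INR N) by (apply lt_0_INR; auto).
      assert (Hw : INR N <= w).
      { unfold w; rewrite S_INR; pose proof PI2_1; nra. }
      rewrite (RInt_ext _ (fun u => f u / sin (PI * u) * sin (w * u))).
      - eapply Rle_trans; [apply HK; lra|].
        pose proof (Rabs_pos K); pose proof (Rle_abs K).
        apply Rle_trans with ((Rabs K + 1) * / INR N).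
        + unfold Rdiv; apply Rle_trans with ((Rabs K + 1) * / w).
          * apply Rmult_le_compat_r; [left; apply Rinv_0_lt_compat|]; lra.
          * apply Rmult_le_compat_l; [lra|apply Rinv_le_contravar; lra].
        + apply Rle_trans with ((Rabs K + 1) * (eps / (4 * (Rabs K + 1)))).
          * apply Rmult_le_compat_l; lra.
          * right; field; lra.
      - intros x Hx; rewrite Rmin_left, Rmax_right in Hx by lra.
        unfold w; rewrite <- sin_mul_dirichlet; eqR; field; apply Hsin; lra. }
    eapply Rle_lt_trans; [apply Rabs_triang|].
    eapply Rle_lt_trans; [apply Rplus_le_compat_l, Rabs_triang|].
    lra.
Qed.

Lemma RInt_mul_dirichlet (f : R -> R) (M : nat) : cont f ->
  RInt (fun u => f u * dirichlet M u) 0 1 = RInt f 0 1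
    + sum_f_R0 (fun n => 2 * RInt (fun u => f u * cos (2 * PI * INR (S n) * u)) 0 1) M.
Proof.
  intros Cf.
  assert (C : forall n, ex_RInt (fun u => f u * cos (2 * PI * INR (S n) * u)) 0 1).
  { intros n; apply cont_ex_RInt, cont_mul; auto using cont_cos_lin. }
  rewrite (RInt_ext _ (fun u => f u
    + sum_f_R0 (fun n => 2 * (f u * cos (2 * PI * INR (S n) * u))) M)).
  - rewrite RInt_add; auto using cont_ex_RInt.
    + f_equal; rewrite (RInt_sum_f_R0 (fun n u => 2 * (f u * cos (2 * PI * INR (S n) * u)))).
      * apply sum_eq; intros n _; apply RInt_mul_l; auto.
      * intros n; apply ex_RInt_mul_l; auto.
    + apply (ex_RInt_sum_f_R0 (fun n u => 2 * (f u * cos (2 * PI * INR (S n) * u)))).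
      intros n; apply ex_RInt_mul_l; auto.
  - intros u _; unfold dirichlet; rewrite Rmult_plus_distr_l, Rmult_1_r; f_equal.
    rewrite scal_sum, scal_sum; apply sum_eq; intros; ring.
Qed.

Lemma RInt_cos_INR (n : nat) : RInt (fun u => cos (2 * PI * INR (S n) * u)) 0 1 = 0.
Proof.
  assert (0 < INR (S n)) by (apply lt_0_INR; lia); pose proof PI_RGT_0.
  assert (Hw : 2 * PI * INR (S n) <> 0) by (apply Rgt_not_eq; nra).
  assert (Hs : sin (2 * PI * INR (S n) * 1) = 0).
  { replace (2 * PI * INR (S n) * 1) with (0 + 2 * INR (S n) * PI) by ring.
    rewrite sin_period; apply sin_0. }
  revert Hw Hs; generalize (2 * PI * INR (S n)) as w; intros w Hw Hs.
  rewrite (RInt_FTC (fun u => sin (w * u) / w)).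
  - rewrite Hs, Rmult_0_r, sin_0; lra.
  - intros x _; auto_derive; [trivial|]; field; auto.
  - intros x _; apply cont_cos_lin.
Qed.

Lemma RInt_reflect (f : R -> R) : cont f -> RInt (fun u => f (1 - u)) 0 1 = RInt f 0 1.
Proof.
  intros Cf.
  pose proof (RInt_comp_lin f (-1) 1 0 1 ltac:(apply cont_ex_RInt; auto)) as H.
  unfold scal in H; simpl in H; unfold mult in H; simpl in H.
  replace (-1 * 0 + 1) with 1 in H by ring; replace (-1 * 1 + 1) with 0 in H by ring.
  rewrite <- (opp_RInt_swap f 0 1) in H by (apply cont_ex_RInt; auto).
  unfold opp in H; simpl in H.
  assert (C : cont (fun y => f (-1 * y + 1))).
  { intros x; apply (continuous_comp (fun y => -1 * y + 1) f); auto.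
    apply ex_derive_cont; auto_derive; trivial. }
  rewrite RInt_mul_l in H by auto using cont_ex_RInt.
  rewrite (RInt_ext _ (fun y => f (-1 * y + 1))); [lra|].
  intros x _; f_equal; ring.
Qed.

(* No periodicity is assumed: averaging [f u] and [f (1 - u)] makes the endpoint values agree. *)
Lemma fourier_series_0 (f df : R -> R) : (forall x, is_derive f x (df x)) -> cont df ->
  is_series (fun n => 2 * RInt (fun u => f u * cos (2 * PI * INR (S n) * u)) 0 1)
    ((f 0 + f 1) / 2 - RInt f 0 1).
Proof.
  intros Hf Hdf.
  assert (Cf : cont f) by (intros x; apply ex_derive_cont; exists (df x); auto).
  assert (Cr : cont (fun u => f (1 - u))).
  { intros x; apply (continuous_comp (fun y => 1 - y) f); auto.
    apply ex_derive_cont; auto_derive; trivial. }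
  set (m := (f 0 + f 1) / 2).
  set (g := fun u => / 2 * (f u + f (1 - u)) + - m).
  assert (Cg : cont g).
  { apply cont_add; [|apply cont_const]; apply cont_mul; [apply cont_const|].
    apply cont_add; auto. }
  apply is_series_eps; intros eps He.
  destruct (RInt_dirichlet_0 g (fun u => / 2 * (df u - df (1 - u)))) with (eps := eps)
    as (N & HN); auto.
  - intros x; unfold g; auto_derive.
    + split; [exists (df x); auto|]; split; [exists (df (1 - x))|]; auto.
    + replace (Derive (fun y => f y) x) with (df x)
        by (symmetry; apply is_derive_unique, Hf).
      replace (Derive (fun y => f y) (1 + - x)) with (df (1 - x))
        by (symmetry; apply is_derive_unique, Hf).
      ring.
  - apply cont_mul; [apply cont_const|].
    intros x; apply (continuous_minus df (fun u => df (1 - u))); auto.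
    apply (continuous_comp (fun y => 1 - y) df); auto.
    apply ex_derive_cont; auto_derive; trivial.
  - unfold g, m; rewrite Rminus_0_r; field.
  - unfold g, m; rewrite Rminus_diag; field.
  - exists N; intros M HM; specialize (HN M HM).
    rewrite RInt_mul_dirichlet in HN by auto.
    (* Against a weight invariant under [u -> 1 - u], the average of [f u] and [f (1 - u)]
       integrates like [f]. The cosines of integer frequency are such weights and have mean zero, so
       [g] and [f] share their cosine coefficients. *)
    assert (Hg : forall p : R -> R, cont p -> (forall u, p (1 - u) = p u) ->
      RInt (fun u => g u * p u) 0 1 = RInt (fun u => f u * p u) 0 1 - m * RInt p 0 1).
    { intros p Cp Hp.
      rewrite (RInt_ext _ (fun u => (/ 2 * (f u * p u) + / 2 * (f (1 - u) * p (1 - u))) + - m * p u)).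
      - rewrite RInt_add, RInt_add, !RInt_mul_l.
        + rewrite (RInt_reflect (fun u => f u * p u)) by (apply cont_mul; auto).
          eqR; lra.
        + apply cont_ex_RInt; auto.
        + apply cont_ex_RInt; intros x.
          apply (continuous_comp (fun y => 1 - y) (fun u => f u * p u)).
          * apply ex_derive_cont; auto_derive; trivial.
          * apply cont_mul; auto.
        + apply cont_ex_RInt, cont_mul; auto.
        + apply ex_RInt_mul_l, cont_ex_RInt, cont_mul; auto.
        + apply ex_RInt_mul_l, cont_ex_RInt; intros x.
          apply (continuous_comp (fun y => 1 - y) (fun u => f u * p u)).
          * apply ex_derive_cont; auto_derive; trivial.
          * apply cont_mul; auto.
        + apply ex_RInt_add; apply ex_RInt_mul_l, cont_ex_RInt; [apply cont_mul; auto|].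
          intros x; apply (continuous_comp (fun y => 1 - y) (fun u => f u * p u)).
          * apply ex_derive_cont; auto_derive; trivial.
          * apply cont_mul; auto.
        + apply ex_RInt_mul_l, cont_ex_RInt; auto.
      - intros u _; unfold g; rewrite Hp; eqR; lra. }
    assert (G1 : RInt g 0 1 = RInt f 0 1 - m).
    { rewrite (RInt_ext g (fun u => g u * 1)) by (intros; eqR; ring).
      rewrite (Hg (fun _ => 1)); auto using cont_const.
      rewrite RInt_const; unfold scal; simpl; unfold mult; simpl.
      rewrite (RInt_ext (fun u => f u * 1) f) by (intros; eqR; ring); lra. }
    rewrite G1 in HN.
    rewrite (sum_eq _ (fun n => 2 * RInt (fun u => f u * cos (2 * PI * INR (S n) * u)) 0 1)) in HN.
    + match goal with |- Rabs ?a < _ => match type of HN with Rabs ?b < _ =>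
        replace a with b by ring end end; exact HN.
    + intros n _; rewrite Hg, RInt_cos_INR; [ring|apply cont_cos_lin|].
      intros u; apply cos_2PI_INR_sub.
Qed.


(** * The partial fraction expansion of the Bose factor *)

Lemma INR_S_pos (n : nat) : 0 < INR (S n).
Proof. apply lt_0_INR; lia. Qed.

Lemma cos_2PI_INR (n k : nat) : cos (2 * PI * INR n * INR k) = 1.
Proof.
  replace (2 * PI * INR n * INR k) with (0 + 2 * INR (n * k) * PI) by (rewrite mult_INR; ring).
  rewrite cos_period; apply cos_0.
Qed.

Lemma sin_2PI_INR (n k : nat) : sin (2 * PI * INR n * INR k) = 0.
Proof.
  replace (2 * PI * INR n * INR k) with (0 + 2 * INR (n * k) * PI) by (rewrite mult_INR; ring).
  rewrite sin_period; apply sin_0.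
Qed.

Lemma RInt_exp_cos (w v : R) : 0 < w -> sin v = 0 -> cos v = 1 ->
  RInt (fun u => exp (- (w * u)) * cos (v * u)) 0 1 = w * (1 - exp (- w)) / (w ^ 2 + v ^ 2).
Proof.
  intros Hw Hs Hc.
  assert (Hp : 0 < w ^ 2 + v ^ 2) by nra.
  rewrite (RInt_FTC (fun u => exp (- (w * u)) * (v * sin (v * u) - w * cos (v * u)) / (w ^ 2 + v ^ 2))).
  - rewrite !Rmult_1_r, !Rmult_0_r, Hs, Hc, Ropp_0, sin_0, cos_0, exp_0; eqR; field; lra.
  - intros x _; auto_derive; [trivial|]. eqR; field; lra.
  - intros x _; apply cont_mul; auto using cont_cos_lin.
    intros y; apply ex_derive_cont; auto_derive; trivial.
Qed.

(* The Fourier series of [fun u => exp (- (2 * PI * x * u))] on [0, 1], evaluated at the endpoints. *)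
Lemma bose_partial_fractions (x : R) : 0 < x ->
  x / (exp (2 * PI * x) - 1)
  = - (x / 2) + / (2 * PI) + / PI * Series (fun n => x ^ 2 / (x ^ 2 + INR (S n) ^ 2)).
Proof.
  intros Hx; pose proof PI_RGT_0 as Hpi.
  set (w := 2 * PI * x).
  assert (Hw : 0 < w) by (unfold w; nra).
  assert (HE : exp (- w) < 1) by (rewrite <- exp_0; apply exp_increasing; lra).
  pose proof (exp_pos (- w)) as HE0.
  assert (H := fourier_series_0 (fun u => exp (- (w * u))) (fun u => - w * exp (- (w * u)))).
  assert (H' : is_series (fun n => x ^ 2 / (x ^ 2 + INR (S n) ^ 2))
    (x * PI / (1 - exp (- w)) * ((1 + exp (- w)) / 2 - (1 - exp (- w)) / w))).
  { apply is_series_ext with (fun n => x * PI / (1 - exp (- w)) *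
      (2 * RInt (fun u => exp (- (w * u)) * cos (2 * PI * INR (S n) * u)) 0 1)).
    - intros n; rewrite RInt_exp_cos; auto.
      + pose proof (INR_S_pos n).
        replace (w ^ 2 + (2 * PI * INR (S n)) ^ 2) with (4 * PI ^ 2 * (x ^ 2 + INR (S n) ^ 2))
          by (unfold w; ring).
        replace (w * (1 - exp (- w))) with (2 * PI * x * (1 - exp (- w))) by reflexivity.
        eqR; field; repeat split; try lra; apply Rgt_not_eq; nra.
      + rewrite <- (Rmult_1_r (2 * PI * INR (S n))); apply (sin_2PI_INR (S n) 1).
      + rewrite <- (Rmult_1_r (2 * PI * INR (S n))); apply (cos_2PI_INR (S n) 1).
    - apply is_series_mul_l.
      cbv beta in H.
      rewrite Rmult_0_r, Ropp_0, exp_0, Rmult_1_r in H.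
      rewrite (RInt_FTC (fun u => - exp (- (w * u)) / w) (fun u => exp (- (w * u)))) in H.
      + rewrite Rmult_0_r, Ropp_0, exp_0, Rmult_1_r in H.
        replace ((1 - exp (- w)) / w) with (- exp (- w) / w - - (1) / w) by (field; lra).
        apply H.
        * intros y; auto_derive; [trivial|ring].
        * intros y; apply ex_derive_cont; auto_derive; trivial.
      + intros y _; auto_derive; [trivial|]; field; lra.
      + intros y _; apply ex_derive_cont; auto_derive; trivial. }
  rewrite (is_series_unique _ _ H').
  replace (exp w) with (/ exp (- w)) by (rewrite exp_Ropp, Rinv_inv; reflexivity).
  set (E := exp (- w)) in *; clearbody E; clear H; unfold w.
  field; repeat split; lra.
Qed.

(** * The Jacobi theta functional equation *)

Lemma RInt_cos_shift (h : R -> R) (n K : nat) : cont h ->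
  RInt (fun u => h (u + INR K) * cos (2 * PI * INR n * u)) 0 1
  = RInt (fun v => h v * cos (2 * PI * INR n * v)) (INR K) (INR (S K)).
Proof.
  intros Ch.
  pose proof (RInt_comp_lin (fun v => h v * cos (2 * PI * INR n * v)) 1 (INR K) 0 1) as H.
  unfold scal in H; simpl scal in H; unfold mult in H; simpl mult in H.
  rewrite S_INR.
  replace (1 * 0 + INR K) with (INR K) in H by ring.
  replace (1 * 1 + INR K) with (INR K + 1) in H by ring.
  rewrite <- H.
  - apply RInt_ext; intros x _; eqR.
    rewrite !Rmult_1_l; f_equal.
    replace (2 * PI * INR n * (x + INR K)) with (2 * PI * INR n * x + 2 * INR (n * K) * PI)
      by (rewrite mult_INR; ring).
    symmetry; apply cos_period.
  - apply cont_ex_RInt, cont_mul; auto using cont_cos_lin.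
Qed.

(** Poisson summation on [[0, K]]: the Fourier series of the unit pieces [h (u + i)] are added. Each
    converges to the mean of its endpoint values, so interior integers receive weight one and only
    the two ends keep weight one half. *)
Lemma poisson_finite (h dh : R -> R) (K : nat) : (forall x, is_derive h x (dh x)) -> cont dh ->
  is_series (fun n => 2 * RInt (fun u => h u * cos (2 * PI * INR (S n) * u)) 0 (INR K))
    (sum_f_R0 (fun m => h (INR m)) K - (h 0 + h (INR K)) / 2 - RInt h 0 (INR K)).
Proof.
  intros Hh Hdh.
  assert (Ch : cont h) by (intros x; apply ex_derive_cont; exists (dh x); auto).
  induction K.
  - simpl INR at 1 3; rewrite RInt_point; unfold zero; simpl.
    replace (h 0 - (h 0 + h 0) / 2 - 0) with 0 by field.
    apply is_series_ext with (fun _ => 0).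
    + intros n; rewrite RInt_point; unfold zero; simpl; ring.
    + apply is_series_eps; intros eps He; exists 0%nat; intros M _.
      rewrite sum_eq_R0, Rminus_0_r, Rabs_R0; auto.
  - assert (D1 : forall x, is_derive (fun u => h (u + INR K)) x (dh (x + INR K))).
    { intros x; eapply is_derive_eq.
      - apply (is_derive_comp h (fun u => u + INR K) x); [apply Hh|].
        auto_derive; [trivial|reflexivity].
      - unfold scal; simpl; unfold mult; simpl; ring. }
    assert (D2 : cont (fun u => dh (u + INR K))).
    { intros x; apply (continuous_comp (fun u => u + INR K) dh); auto.
      apply ex_derive_cont; auto_derive; trivial. }
    assert (H := fourier_series_0 _ _ D1 D2).
    cbv beta in H; rewrite Rplus_0_l, (Rplus_comm 1), <- S_INR in H.
    rewrite tech5.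
    rewrite (RInt_split h 0 (INR K)) by auto using cont_ex_RInt.
    replace (RInt h (INR K) (INR (S K))) with (RInt (fun u => h (u + INR K)) 0 1).
    + assert (H2 := is_series_plus _ _ _ _ IHK H).
      clear H; match type of H2 with is_series _ ?l => match goal with |- is_series _ ?l' =>
        replace l' with l by (unfold plus; cbn -[INR]; lra) end end.
      revert H2; apply is_series_ext; intros n.
      rewrite RInt_cos_shift by auto.
      rewrite (RInt_split _ 0 (INR K) (INR (S K))).
      * unfold plus; cbn -[INR RInt]; eqR; ring.
      * apply cont_ex_RInt, cont_mul; auto using cont_cos_lin.
      * apply cont_ex_RInt, cont_mul; auto using cont_cos_lin.
    + pose proof (RInt_cos_shift h 0 K Ch) as E; simpl INR in E.
      rewrite (RInt_ext (fun u => h (u + INR K)) (fun u => h (u + INR K) * cos (2 * PI * 0 * u))).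
      * simpl INR; rewrite E; apply RInt_ext; intros x _.
        rewrite Rmult_0_r, Rmult_0_l, cos_0; eqR; ring.
      * intros x _; rewrite Rmult_0_r, Rmult_0_l, cos_0; eqR; ring.
Qed.


(** The cosine transform of the Gaussian, cut at [L] because Poisson summation is applied on bounded
    intervals; [L] tends to infinity only inside the series. *)
Definition gauss_cos (c L w : R) : R := RInt (fun v => gm 0 c v * cos (w * v)) 0 L.

Lemma is_derive_gm_0 (c x : R) : is_derive (gm 0 c) x (- (2 * c) * gm 1 c x).
Proof. unfold gm; auto_derive; [trivial|]; simpl; ring. Qed.

Lemma is_derive_gm_1 (c x : R) :
  is_derive (gm 1 c) x (gm 0 c x - 2 * c * gm 2 c x).
Proof. unfold gm; auto_derive; [trivial|]; simpl; ring. Qed.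

Lemma RInt_gm_1_sin (c L w : R) : 0 < c ->
  RInt (fun v => gm 1 c v * sin (w * v)) 0 L
  = w / (2 * c) * gauss_cos c L w - gm 0 c L * sin (w * L) / (2 * c).
Proof.
  intros Hc.
  assert (H : RInt (fun v => gm 1 c v * sin (w * v) + - (w / (2 * c)) * (gm 0 c v * cos (w * v))) 0 L
    = - (gm 0 c L * sin (w * L)) / (2 * c) - - (gm 0 c 0 * sin (w * 0)) / (2 * c)).
  { apply (RInt_FTC (fun v => - (gm 0 c v * sin (w * v)) / (2 * c))).
    - intros x _; eapply is_derive_eq.
      + apply (is_derive_ext (fun v => - / (2 * c) * (gm 0 c v * sin (w * v)))).
        * intros v; eqR; field; lra.
        * apply is_derive_scal.
          apply (is_derive_mult (gm 0 c) (fun v => sin (w * v)) x).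
          -- apply is_derive_gm_0.
          -- auto_derive; [trivial|reflexivity].
          -- intros; apply Rmult_comm.
      + unfold plus, mult; cbn -[gm]; field; lra.
    - intros x _; apply cont_add.
      + apply cont_mul; auto using cont_gm, cont_sin_lin.
      + apply cont_mul; auto using cont_const.
        apply cont_mul; auto using cont_gm, cont_cos_lin. }
  rewrite RInt_add, RInt_mul_l in H.
  - rewrite Rmult_0_r, sin_0 in H; unfold gauss_cos; lra.
  - apply cont_ex_RInt, cont_mul; auto using cont_gm, cont_cos_lin.
  - apply cont_ex_RInt, cont_mul; auto using cont_gm, cont_sin_lin.
  - apply ex_RInt_mul_l, cont_ex_RInt, cont_mul; auto using cont_gm, cont_cos_lin.
Qed.

Lemma continuity_2d_pt_snd (g : R -> R) (x y : R) : continuous g y -> continuity_2d_pt (fun _ v => g v) x y.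
Proof.
  intros H; apply (continuity_1d_2d_pt_comp g (fun _ v => v)).
  - apply continuity_pt_filterlim, H.
  - apply continuity_2d_pt_id2.
Qed.

(** Differentiation under the integral and one integration by parts give the linear equation
    [y' = - w / (2 c) y] of the Gaussian transform, perturbed by a boundary term at the cut. *)
Lemma is_derive_gauss_cos (c L w : R) : 0 < c ->
  is_derive (gauss_cos c L) w
    (gm 0 c L * sin (w * L) / (2 * c) - w / (2 * c) * gauss_cos c L w).
Proof.
  intros Hc.
  assert (HD : forall v u, is_derive (fun z => gm 0 c v * cos (z * v)) u (- (gm 1 c v * sin (u * v)))).
  { intros v u; auto_derive; [trivial|]; unfold gm; simpl; ring. }
  assert (HD' : forall v u, Derive (fun z => gm 0 c v * cos (z * v)) u = - (gm 1 c v * sin (u * v))).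
  { intros; apply is_derive_unique, HD. }
  eapply is_derive_eq.
  - apply (is_derive_RInt_param (fun z v => gm 0 c v * cos (z * v)) 0 L w).
    + apply filter_forall; intros u v _; exists (- (gm 1 c v * sin (u * v))); apply HD.
    + intros v _.
      apply continuity_2d_pt_ext with (fun u v => - (gm 1 c v * sin (u * v))).
      * intros; symmetry; apply HD'.
      * apply continuity_2d_pt_opp, continuity_2d_pt_mult.
        -- apply continuity_2d_pt_snd, cont_gm.
        -- apply (continuity_1d_2d_pt_comp sin (fun u v => u * v)).
           ++ apply continuity_sin.
           ++ apply continuity_2d_pt_mult; [apply continuity_2d_pt_id1|apply continuity_2d_pt_id2].
    + apply filter_forall; intros u; apply cont_ex_RInt, cont_mul; auto using cont_gm, cont_cos_lin.
  - rewrite (RInt_ext _ (fun v => -1 * (gm 1 c v * sin (w * v)))).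
    + rewrite RInt_mul_l, RInt_gm_1_sin; auto; [eqR; ring|].
      apply cont_ex_RInt, cont_mul; auto using cont_gm, cont_sin_lin.
    + intros v _; rewrite HD'; eqR; ring.
Qed.

(** The integrating factor [exp (w^2 / (4 c))] leaves only the boundary term in the derivative. The
    mean value theorem evaluates it at some [z <= w], where the two exponentials multiply to at most
    one. *)
Lemma gauss_cos_error (c L w : R) : 0 < c -> 0 <= w ->
  Rabs (gauss_cos c L w - gauss_cos c L 0 * exp (- (w ^ 2 / (4 * c))))
  <= w / (2 * c) * gm 0 c L.
Proof.
  intros Hc Hw.
  set (G := fun z => gauss_cos c L z * exp (z ^ 2 / (4 * c))).
  set (dG := fun z => gm 0 c L * sin (z * L) / (2 * c) * exp (z ^ 2 / (4 * c))).
  assert (HG : forall z, is_derive G z (dG z)).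
  { intros z; unfold G, dG; eapply is_derive_eq.
    - apply (is_derive_mult (gauss_cos c L) (fun z => exp (z ^ 2 / (4 * c))) z).
      + apply is_derive_gauss_cos; auto.
      + auto_derive; [trivial|reflexivity].
      + intros; apply Rmult_comm.
    - unfold plus, mult; cbn -[gm gauss_cos]; unfold Rdiv; field; lra. }
  destruct (MVT_gen G 0 w dG) as (z & Hz & HE).
  - intros; apply HG.
  - intros x _; apply continuity_pt_filterlim; apply ex_derive_cont; exists (dG x); apply HG.
  - rewrite Rmin_left, Rmax_right in Hz by auto.
    assert (E : gauss_cos c L w - gauss_cos c L 0 * exp (- (w ^ 2 / (4 * c)))
      = (G w - G 0) * exp (- (w ^ 2 / (4 * c)))).
    { unfold G; rewrite Rmult_minus_distr_r, Rmult_assoc, <- exp_plus, Rplus_opp_r, exp_0.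
      replace (0 ^ 2 / (4 * c)) with 0 by (field; lra); rewrite exp_0; ring. }
    rewrite E, HE; unfold dG.
    assert (HL : 0 < gm 0 c L) by (unfold gm; simpl; rewrite Rmult_1_l; apply exp_pos).
    rewrite Rminus_0_r.
    replace (gm 0 c L * sin (z * L) / (2 * c) * exp (z ^ 2 / (4 * c)) * w * exp (- (w ^ 2 / (4 * c))))
      with (w / (2 * c) * gm 0 c L * (sin (z * L) * (exp (z ^ 2 / (4 * c)) * exp (- (w ^ 2 / (4 * c))))))
      by (field; lra).
    assert (Hq : 0 <= w / (2 * c) * gm 0 c L).
    { apply Rmult_le_pos; [apply Rdiv_le_0_compat|]; lra. }
    rewrite Rabs_mult, (Rabs_pos_eq _ Hq), <- (Rmult_1_r (w / (2 * c) * gm 0 c L)) at 1.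
    rewrite Rmult_1_r; rewrite <- (Rmult_1_r (w / (2 * c) * gm 0 c L)) at 2.
    apply Rmult_le_compat_l; auto.
    rewrite Rabs_mult, <- exp_plus, (Rabs_pos_eq (exp _)) by (left; apply exp_pos).
    rewrite <- (Rmult_1_r 1); apply Rmult_le_compat; auto using Rabs_pos.
    + left; apply exp_pos.
    + apply Rabs_le, SIN_bound.
    + rewrite <- exp_0; apply exp_le_exp.
      assert (z ^ 2 / (4 * c) <= w ^ 2 / (4 * c)); [|lra].
      apply Rmult_le_compat_r; [left; apply Rinv_0_lt_compat; lra|nra].
Qed.

Lemma is_lim_gm_0 (c : R) : 0 < c -> is_lim (gm 0 c) p_infty 0.
Proof.
  intros Hc; apply is_lim_squeeze_0 with (gm 1 c) 1; [|apply is_lim_gm; auto].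
  intros x Hx; rewrite Rabs_pos_eq by (apply gm_ge_0; lra).
  unfold gm; simpl; pose proof (exp_pos (- c * (x * (x * 1)))); nra.
Qed.

Lemma is_lim_gauss_cos (c w : R) : 0 < c -> 0 <= w ->
  is_lim (fun L => gauss_cos c L w) p_infty (mu 0 c * exp (- (w ^ 2 / (4 * c)))).
Proof.
  intros Hc Hw.
  apply is_lim_ext with (fun L => exp (- (w ^ 2 / (4 * c))) * gauss_cos c L 0 +
    (gauss_cos c L w - gauss_cos c L 0 * exp (- (w ^ 2 / (4 * c))))).
  - intros L; ring.
  - replace (Finite (mu 0 c * exp (- (w ^ 2 / (4 * c)))))
      with (Finite (exp (- (w ^ 2 / (4 * c))) * mu 0 c + 0)) by (f_equal; ring).
    apply is_lim_plus'.
    + apply (is_lim_scal_l _ (exp (- (w ^ 2 / (4 * c)))) p_infty (mu 0 c)).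
      apply is_lim_ext with (fun L => RInt (gm 0 c) 0 L); [|apply improper_gm; auto].
      intros L; apply RInt_ext; intros x _; rewrite Rmult_0_l, cos_0; eqR; ring.
    + apply is_lim_squeeze_0 with (fun L => w / (2 * c) * gm 0 c L) 0.
      * intros; apply gauss_cos_error; auto.
      * pose proof (is_lim_scal_l _ (w / (2 * c)) _ _ (is_lim_gm_0 c Hc)) as H.
        simpl in H; rewrite Rmult_0_r in H; exact H.
Qed.

Lemma RInt_gm_le_mu (m : nat) (c b : R) : 0 < c -> 0 <= b -> RInt (gm m c) 0 b <= mu m c.
Proof.
  intros Hc Hb; apply (improper_upper (gm m c)); auto using cont_gm, improper_gm.
  intros; apply gm_ge_0; auto.
Qed.

(* Two integrations by parts; the boundary term of order [/ w] vanishes because [sin (w * INR K) = 0]. *)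
Lemma gauss_cos_bound (c w : R) (K : nat) : 0 < c -> 0 < w -> sin (w * INR K) = 0 ->
  Rabs (gauss_cos c (INR K) w) <= (2 + 2 * c * mu 0 c + 4 * c ^ 2 * mu 2 c) / w ^ 2.
Proof.
  intros Hc Hw Hs; set (L := INR K) in *.
  assert (HL0 : 0 <= L) by apply pos_INR.
  (* The surviving boundary term needs a bound independent of [K]: it vanishes for [K = 0], and is
     at most [2 / K] otherwise. *)
  assert (HL : 0 <= 2 * c * gm 1 c L <= 2).
  { assert (HL' : 0 <= gm 1 c L) by (apply gm_ge_0; auto); split; [nra|].
    unfold L; destruct K.
    - unfold gm; simpl; lra.
    - assert (1 <= INR (S K)) by (apply (le_INR 1); lia).
      pose proof (gm_le_inv 1 c (INR (S K)) (le_n 1) Hc H) as B.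
      change (INR 1) with 1 in B.
      replace ((1 / c) ^ 1 / INR (S K)) with (/ c * / INR (S K)) in B by (field; lra).
      assert (/ INR (S K) <= 1) by (rewrite <- Rinv_1; apply Rinv_le_contravar; lra).
      assert (c * gm 1 c (INR (S K)) <= c * (/ c * / INR (S K))) by (apply Rmult_le_compat_l; lra).
      replace (c * (/ c * / INR (S K))) with (/ INR (S K)) in H1 by (field; lra).
      lra. }
  (* The second derivative of [gm 0 c]. *)
  set (dd := fun v => 4 * c ^ 2 * gm 2 c v + - (2 * c) * gm 0 c v).
  assert (Cdd : cont dd).
  { apply cont_add; apply cont_mul; auto using cont_const, cont_gm. }
  assert (H : RInt (fun v => gm 0 c v * cos (w * v) + / w ^ 2 * (dd v * cos (w * v))) 0 L
    = (gm 0 c L * (sin (w * L) / w) + - (2 * c) * gm 1 c L * (cos (w * L) / w ^ 2))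
      - (gm 0 c 0 * (sin (w * 0) / w) + - (2 * c) * gm 1 c 0 * (cos (w * 0) / w ^ 2))).
  { apply (RInt_FTC (fun v => gm 0 c v * (sin (w * v) / w) + - (2 * c) * gm 1 c v * (cos (w * v) / w ^ 2))).
    - intros x _; eapply is_derive_eq.
      + apply (is_derive_plus (fun v => gm 0 c v * (sin (w * v) / w))
           (fun v => - (2 * c) * gm 1 c v * (cos (w * v) / w ^ 2)) x).
        * apply (is_derive_mult (gm 0 c) (fun v => sin (w * v) / w) x).
          -- apply is_derive_gm_0.
          -- auto_derive; [trivial|reflexivity].
          -- intros; apply Rmult_comm.
        * apply (is_derive_mult (fun v => - (2 * c) * gm 1 c v) (fun v => cos (w * v) / w ^ 2) x).
          -- apply is_derive_scal, is_derive_gm_1.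
          -- auto_derive; [trivial|reflexivity].
          -- intros; apply Rmult_comm.
      + unfold dd, plus, mult; cbn -[gm pow]; simpl (w ^ 2); field; lra.
    - intros x _; apply cont_add.
      + apply cont_mul; auto using cont_gm, cont_cos_lin.
      + apply cont_mul; auto using cont_const; apply cont_mul; auto using cont_cos_lin. }
  assert (E1 : ex_RInt (fun v => gm 0 c v * cos (w * v)) 0 L).
  { apply cont_ex_RInt, cont_mul; auto using cont_gm, cont_cos_lin. }
  assert (E2 : ex_RInt (fun v => dd v * cos (w * v)) 0 L).
  { apply cont_ex_RInt, cont_mul; auto using cont_cos_lin. }
  rewrite RInt_add, RInt_mul_l in H by auto using ex_RInt_mul_l.
  fold (gauss_cos c L w) in H.
  rewrite Hs, Rmult_0_r, sin_0 in H.
  replace (gm 1 c 0) with 0 in H by (unfold gm; simpl; ring).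
  assert (E : gauss_cos c L w
    = / w ^ 2 * (- (RInt (fun v => dd v * cos (w * v)) 0 L) - 2 * c * gm 1 c L * cos (w * L))).
  { unfold Rdiv in H; rewrite !Rmult_0_l in H; lra. }
  assert (B : Rabs (RInt (fun v => dd v * cos (w * v)) 0 L) <= 2 * c * mu 0 c + 4 * c ^ 2 * mu 2 c).
  { apply Rle_trans with (RInt (fun v => 4 * c ^ 2 * gm 2 c v + 2 * c * gm 0 c v) 0 L).
    - apply Rle_trans with (RInt (fun v => Rabs (dd v * cos (w * v))) 0 L).
      + apply abs_RInt_le; auto.
      + apply RInt_le; auto.
        * apply (ex_RInt_norm (fun v => dd v * cos (w * v))); auto.
        * apply cont_ex_RInt, cont_add; apply cont_mul; auto using cont_const, cont_gm.
        * intros x Hx; rewrite Rabs_mult.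
          pose proof (gm_ge_0 2 c x ltac:(lra)); pose proof (gm_ge_0 0 c x ltac:(lra)).
          assert (0 <= 4 * c ^ 2 * gm 2 c x) by (apply Rmult_le_pos; nra).
          assert (0 <= 2 * c * gm 0 c x) by (apply Rmult_le_pos; nra).
          assert (Rabs (dd x) <= 4 * c ^ 2 * gm 2 c x + 2 * c * gm 0 c x).
          { unfold dd; apply Rabs_le; lra. }
          assert (Rabs (cos (w * x)) <= 1) by apply Rabs_le, COS_bound.
          pose proof (Rabs_pos (dd x)); pose proof (Rabs_pos (cos (w * x))); nra.
    - rewrite RInt_add, !RInt_mul_l by auto using cont_ex_RInt, cont_gm, ex_RInt_mul_l.
      pose proof (RInt_gm_le_mu 0 c L Hc HL0); pose proof (RInt_gm_le_mu 2 c L Hc HL0).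
      assert (0 < c ^ 2) by (apply pow_lt; auto); nra. }
  rewrite E, Rabs_mult, (Rabs_pos_eq (/ w ^ 2)) by (left; apply Rinv_0_lt_compat, pow_lt; auto).
  unfold Rdiv; rewrite Rmult_comm; apply Rmult_le_compat_r.
  { left; apply Rinv_0_lt_compat, pow_lt; auto. }
  eapply Rle_trans; [apply Rabs_triang|]; rewrite !Rabs_Ropp.
  rewrite (Rabs_mult (2 * c * gm 1 c L)), (Rabs_pos_eq (2 * c * gm 1 c L)) by lra.
  assert (Rabs (cos (w * L)) <= 1) by apply Rabs_le, COS_bound.
  pose proof (Rabs_pos (cos (w * L))); nra.
Qed.

(** Half of the theta series without its constant term; [phi] and [psi] are both values of it. *)
Definition theta_tail (c : R) : R := Series (fun n => exp (- c * INR (S n) ^ 2)).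

Lemma exp_opp_le_inv (y : R) : 0 < y -> exp (- y) <= / y.
Proof.
  intros Hy; rewrite exp_Ropp; apply Rinv_le_contravar; auto.
  pose proof (exp_ineq1_le y); lra.
Qed.

Lemma exp_sq_bound (c : R) (n : nat) : 0 < c ->
  Rabs (exp (- c * INR (S n) ^ 2)) <= / c * / INR (S n) ^ 2.
Proof.
  intros Hc; rewrite Rabs_pos_eq by (left; apply exp_pos).
  replace (- c * INR (S n) ^ 2) with (- (c * INR (S n) ^ 2)) by ring.
  assert (0 < INR (S n) ^ 2) by apply pow_lt, INR_S_pos.
  rewrite <- Rinv_mult; apply exp_opp_le_inv, Rmult_lt_0_compat; auto.
Qed.

Lemma ex_series_theta (c : R) : 0 < c -> ex_series (fun n => exp (- c * INR (S n) ^ 2)).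
Proof.
  intros Hc; apply ex_series_dominated with (fun n => / c * / INR (S n) ^ 2).
  - intros; apply exp_sq_bound; auto.
  - apply (ex_series_scal_l (/ c) (fun n => / INR (S n) ^ 2)), ex_series_inv_sq.
Qed.

Lemma filterlim_INR_pinf (F : R -> R) (l : R) : is_lim F p_infty l ->
  filterlim (fun K => F (INR K)) eventually (locally l).
Proof.
  intros H; apply (is_lim_comp_seq F INR p_infty l H).
  - exists 0%nat; intros; discriminate.
  - apply is_lim_seq_INR.
Qed.

(** The series of truncated cosine transforms has its limit computed twice as [K] grows: term by
    term, dominated by the [/ w ^ 2] bound, and through the finite Poisson formula. Keeping [mu 0 c]
    symbolic is what later allows its evaluation. *)
Lemma theta_mu (c : R) : 0 < c ->
  mu 0 c * (1 + 2 * theta_tail (PI ^ 2 / c)) = 1 / 2 + theta_tail c.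
Proof.
  intros Hc; pose proof PI_RGT_0 as Hpi.
  set (D := 2 + 2 * c * mu 0 c + 4 * c ^ 2 * mu 2 c).
  assert (HD : 0 <= D).
  { pose proof (Rabs_pos (gauss_cos c (INR 0) 1)).
    pose proof (gauss_cos_bound c 1 0 Hc ltac:(lra)) as B; simpl INR in *.
    rewrite Rmult_0_r in B; specialize (B sin_0); fold D in B.
    replace (1 ^ 2) with 1 in B by ring; lra. }
  assert (L1 : filterlim (fun K => Series (fun n => 2 * gauss_cos c (INR K) (2 * PI * INR (S n))))
    eventually (locally (Series (fun n => 2 * (mu 0 c * exp (- ((2 * PI * INR (S n)) ^ 2 / (4 * c)))))))).
  { assert (Hb : forall K n, Rabs (2 * gauss_cos c (INR K) (2 * PI * INR (S n)))
      <= D / (2 * PI ^ 2) * / INR (S n) ^ 2).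
    { intros K n; pose proof (INR_S_pos n) as Hn.
      rewrite Rabs_mult, (Rabs_pos_eq 2) by lra.
      replace (D / (2 * PI ^ 2) * / INR (S n) ^ 2) with (2 * (D / (2 * PI * INR (S n)) ^ 2))
        by (field; lra).
      apply Rmult_le_compat_l; [lra|]; apply gauss_cos_bound; auto.
      - apply Rmult_lt_0_compat; lra.
      - apply sin_2PI_INR. }
    assert (Hl : forall n, filterlim (fun K => 2 * gauss_cos c (INR K) (2 * PI * INR (S n)))
      eventually (locally (2 * (mu 0 c * exp (- ((2 * PI * INR (S n)) ^ 2 / (4 * c))))))).
    { intros n; pose proof (INR_S_pos n) as Hn.
      apply (filterlim_INR_pinf (fun L => 2 * gauss_cos c L (2 * PI * INR (S n)))).
      apply (is_lim_scal_l (fun L => gauss_cos c L (2 * PI * INR (S n))) 2 p_infty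
        (mu 0 c * exp (- ((2 * PI * INR (S n)) ^ 2 / (4 * c))))).
      apply is_lim_gauss_cos; auto; apply Rmult_le_pos; lra. }
    apply (filterlim_Series_dominated eventually
      (fun n K => 2 * gauss_cos c (INR K) (2 * PI * INR (S n))) _
      (fun n => D / (2 * PI ^ 2) * / INR (S n) ^ 2)); auto.
    - apply (ex_series_scal_l (D / (2 * PI ^ 2)) (fun n => / INR (S n) ^ 2)), ex_series_inv_sq.
    - apply filter_forall; auto.
    - intros n.
      apply (is_lim_seq_le (fun K => Rabs (2 * gauss_cos c (INR K) (2 * PI * INR (S n))))
        (fun _ => D / (2 * PI ^ 2) * / INR (S n) ^ 2)
        (Rabs (2 * (mu 0 c * exp (- ((2 * PI * INR (S n)) ^ 2 / (4 * c))))))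
        (D / (2 * PI ^ 2) * / INR (S n) ^ 2)); auto.
      + exact (is_lim_seq_abs (fun K => 2 * gauss_cos c (INR K) (2 * PI * INR (S n)))
          (2 * (mu 0 c * exp (- ((2 * PI * INR (S n)) ^ 2 / (4 * c))))) (Hl n)).
      + apply is_lim_seq_const. }
  assert (L2 : filterlim (fun K => Series (fun n => 2 * gauss_cos c (INR K) (2 * PI * INR (S n))))
    eventually (locally (1 / 2 + theta_tail c - mu 0 c))).
  { apply (filterlim_ext (fun K => sum_f_R0 (fun m => gm 0 c (INR m)) K
      - (gm 0 c 0 + gm 0 c (INR K)) / 2 - RInt (gm 0 c) 0 (INR K))).
    - intros K; symmetry; apply is_series_unique.
      apply (poisson_finite (gm 0 c) (fun x => - (2 * c) * gm 1 c x)).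
      + apply is_derive_gm_0.
      + apply cont_mul; auto using cont_const, cont_gm.
    - assert (G0 : gm 0 c 0 = 1).
      { unfold gm; replace (- c * 0 ^ 2) with 0 by ring; rewrite exp_0; simpl; ring. }
      rewrite G0.
      replace (1 / 2 + theta_tail c - mu 0 c)
        with ((1 + theta_tail c) + (- / 2 * (1 + 0) + -1 * mu 0 c)) by lra.
      match goal with |- filterlim ?f _ (locally ?l) => change (is_lim_seq f (Finite l)) end.
      apply (is_lim_seq_ext (fun K => sum_f_R0 (fun m => gm 0 c (INR m)) K
        + (- / 2 * (1 + gm 0 c (INR K)) + -1 * RInt (gm 0 c) 0 (INR K)))).
      { intros; eqR; lra. }
      apply is_lim_seq_plus'; [|apply is_lim_seq_plus'].
      + assert (HS : is_series (fun m => gm 0 c (INR m)) (1 + theta_tail c)).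
        { replace (1 + theta_tail c) with (plus (theta_tail c) (gm 0 c (INR 0)))
            by (simpl INR; rewrite G0; unfold plus; simpl; ring).
          apply (is_series_decr_1 (fun m => gm 0 c (INR m))).
          match goal with |- is_series _ ?l => replace l with (theta_tail c) end.
          - apply is_series_ext with (fun n => exp (- c * INR (S n) ^ 2)).
            + intros n; unfold gm; rewrite pow_O, Rmult_1_l; reflexivity.
            + apply Series_correct, ex_series_theta; auto.
          - unfold plus, opp; cbn -[gm]; ring. }
        apply is_lim_seq_ext with (2 := HS).
        intros n; apply sum_n_Reals.
      + apply (is_lim_seq_scal_l _ (- / 2) (1 + 0)), is_lim_seq_plus'; [apply is_lim_seq_const|].
        apply (filterlim_INR_pinf (gm 0 c)), is_lim_gm_0; auto.
      + apply (is_lim_seq_scal_l _ (-1) (mu 0 c)).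
        apply (filterlim_INR_pinf (fun L => RInt (gm 0 c) 0 L)), improper_gm; auto. }
  pose proof (filterlim_locally_unique _ _ _ L1 L2) as E.
  rewrite Series_scal_l, Series_scal_l in E.
  unfold theta_tail at 1.
  rewrite (Series_ext _ (fun n => exp (- ((2 * PI * INR (S n)) ^ 2 / (4 * c))))); [lra|].
  intros n; f_equal; field; lra.
Qed.

(* [c = PI] is the fixed point of the theta duality, which therefore evaluates the Gaussian integral. *)
Lemma mu_0_PI : mu 0 PI = 1 / 2.
Proof.
  pose proof PI_RGT_0.
  pose proof (theta_mu PI ltac:(lra)) as E.
  replace (PI ^ 2 / PI) with PI in E by (field; lra).
  assert (0 <= theta_tail PI).
  { apply Series_ge_0; [|apply ex_series_theta; lra].
    intros n; left; apply exp_pos. }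
  apply Rmult_eq_reg_r with (1 + 2 * theta_tail PI); lra.
Qed.

Lemma mu_0 (c : R) : 0 < c -> mu 0 c = sqrt PI / (2 * sqrt c).
Proof.
  intros Hc; pose proof PI_RGT_0.
  pose proof (mu_scale PI ltac:(lra)) as E; rewrite mu_0_PI in E.
  assert (0 < sqrt PI) by (apply sqrt_lt_R0; lra).
  assert (0 < sqrt c) by (apply sqrt_lt_R0; lra).
  assert (E1 : mu 0 1 = sqrt PI / 2).
  { apply Rmult_eq_reg_r with (/ sqrt PI); [|apply Rinv_neq_0_compat; lra].
    unfold Rdiv in E; rewrite <- E; field; lra. }
  rewrite mu_scale, E1 by auto; field; lra.
Qed.

Lemma theta_functional (t : R) : 0 < t ->
  1 + 2 * theta_tail (PI / t) = sqrt t * (1 + 2 * theta_tail (PI * t)).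
Proof.
  intros Ht; pose proof PI_RGT_0.
  pose proof (theta_mu (PI * t) ltac:(nra)) as E.
  replace (PI ^ 2 / (PI * t)) with (PI / t) in E by (field; lra).
  rewrite mu_0, sqrt_mult in E by nra.
  assert (0 < sqrt PI) by (apply sqrt_lt_R0; lra).
  assert (0 < sqrt t) by (apply sqrt_lt_R0; lra).
  replace (1 + 2 * theta_tail (PI * t)) with (2 * (1 / 2 + theta_tail (PI * t))) by lra.
  rewrite <- E; field; lra.
Qed.


(** * Integrating the partial fractions against a Gaussian monomial *)

(** The two tangent inequalities give [0 <= F (x + h) - F x - h * g x <= h * (g (x + h) - g x)], so
    the error of the difference quotient is at most the oscillation of [g]. *)
Lemma is_derive_of_tangents (F g : R -> R) (x : R) : continuous g x ->
  locally x (fun y => F x + (y - x) * g x <= F y /\ F y + (x - y) * g y <= F x) ->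
  is_derive F x (g x).
Proof.
  intros Hg HF; apply is_derive_Reals; intros eps He.
  destruct (filter_and _ _ HF (continuous_eps_inv g x eps Hg He)) as [d Hd].
  exists d; intros h Hh Hhd.
  destruct (Hd (x + h)) as [[H1 H2] H3].
  { change (Rabs (x + h - x) < d); replace (x + h - x) with h by ring; auto. }
  replace (x + h - x) with h in H1 by ring; replace (x - (x + h)) with (- h) in H2 by ring.
  eapply Rle_lt_trans; [|exact H3].
  replace ((F (x + h) - F x) / h - g x) with ((F (x + h) - F x - h * g x) * / h) by (field; auto).
  rewrite Rabs_mult, Rabs_inv.
  assert (0 < Rabs h) by (apply Rabs_pos_lt; auto).
  apply Rmult_le_reg_r with (Rabs h); auto.
  rewrite Rmult_assoc, Rinv_l, Rmult_1_r by lra.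
  rewrite <- Rabs_mult, Rabs_pos_eq by lra.
  apply Rle_trans with ((g (x + h) - g x) * h); [lra|apply Rle_abs].
Qed.

(** At [s = 0] this is the integrand with denominator [x ^ 2 + y]; differentiating in [s] removes
    the denominator. The factor [b] in the exponent makes [s] the variable [t] of [phi] when
    [b = PI * a]. *)
Definition gm_frac (m : nat) (b y s x : R) : R :=
  gm m b x * (exp (- (b * s * (x ^ 2 + y))) / (x ^ 2 + y)).

Definition frac_int (m : nat) (b y s : R) : R := improper_value (gm_frac m b y s).

Lemma sq_add_pos (x y : R) : 0 < y -> 0 < x ^ 2 + y.
Proof. intros; pose proof (pow2_ge_0 x); lra. Qed.

Lemma cont_gm_frac (m : nat) (b y s : R) : 0 < y -> cont (gm_frac m b y s).
Proof.
  intros Hy; apply cont_mul; [apply cont_gm|].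
  intros x; apply ex_derive_cont; auto_derive.
  pose proof (sq_add_pos x y Hy); simpl in *; lra.
Qed.

Lemma gm_frac_bounds (m : nat) (b y s x : R) : 0 < b -> 0 < y -> 0 <= s -> 0 <= x ->
  0 <= gm_frac m b y s x <= exp (- (b * s * y)) * gm_frac m b y 0 x
  /\ gm_frac m b y 0 x <= / y * gm m b x.
Proof.
  intros Hb Hy Hs Hx; unfold gm_frac.
  pose proof (gm_ge_0 m b x Hx) as Hg; pose proof (sq_add_pos x y Hy) as Hp.
  assert (Hi : 0 < / (x ^ 2 + y)) by (apply Rinv_0_lt_compat; auto).
  replace (- (b * 0 * (x ^ 2 + y))) with 0 by ring; rewrite exp_0; unfold Rdiv.
  pose proof (exp_pos (- (b * s * (x ^ 2 + y)))) as He.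
  repeat split.
  - apply Rmult_le_pos; auto; apply Rmult_le_pos; lra.
  - replace (exp (- (b * s * y)) * (gm m b x * (1 * / (x ^ 2 + y))))
      with (gm m b x * (exp (- (b * s * y)) * / (x ^ 2 + y))) by ring.
    apply Rmult_le_compat_l; auto; apply Rmult_le_compat_r; [lra|].
    apply exp_le_exp; pose proof (pow2_ge_0 x).
    assert (0 <= b * s * x ^ 2) by (repeat apply Rmult_le_pos; lra); lra.
  - rewrite Rmult_1_l, Rmult_comm; apply Rmult_le_compat_r; auto.
    apply Rinv_le_contravar; auto; pose proof (pow2_ge_0 x); lra.
Qed.

Lemma improper_gm_frac_0 (m : nat) (b y : R) : 0 < b -> 0 < y ->
  improper (gm_frac m b y 0) (frac_int m b y 0) /\ 0 <= frac_int m b y 0 <= / y * mu m b.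
Proof.
  intros Hb Hy; apply (improper_dominated (gm_frac m b y 0) (fun x => / y * gm m b x)).
  - apply cont_gm_frac; auto.
  - apply cont_mul; auto using cont_const, cont_gm.
  - intros x Hx; pose proof (gm_frac_bounds m b y 0 x Hb Hy (Rle_refl 0) Hx); lra.
  - apply improper_mul_l; auto using cont_gm, improper_gm.
Qed.

Lemma improper_gm_frac (m : nat) (b y s : R) : 0 < b -> 0 < y -> 0 <= s ->
  improper (gm_frac m b y s) (frac_int m b y s)
  /\ 0 <= frac_int m b y s <= exp (- (b * s * y)) * frac_int m b y 0.
Proof.
  intros Hb Hy Hs.
  apply (improper_dominated (gm_frac m b y s) (fun x => exp (- (b * s * y)) * gm_frac m b y 0 x)).
  - apply cont_gm_frac; auto.
  - apply cont_mul; auto using cont_const, cont_gm_frac.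
  - intros x Hx; apply gm_frac_bounds; auto.
  - apply improper_mul_l; auto using cont_gm_frac; apply improper_gm_frac_0; auto.
Qed.

(* Convexity of [exp] gives the tangent inequality for the integrand; integrated, it yields the
   derivative in [s] without differentiating under the integral sign. *)
Lemma frac_int_tangent (m : nat) (b y s s' : R) : 0 < b -> 0 < y -> 0 <= s -> 0 <= s' ->
  frac_int m b y s + (s' - s) * - (exp (- b * s * y) * (b * mu m (b * (1 + s))))
  <= frac_int m b y s'.
Proof.
  intros Hb Hy Hs Hs'.
  replace ((s' - s) * - (exp (- b * s * y) * (b * mu m (b * (1 + s)))))
    with (- ((s' - s) * b * exp (- b * s * y)) * mu m (b * (1 + s))) by ring.
  assert (0 < b * (1 + s)) by (apply Rmult_lt_0_compat; lra).
  apply (improper_le (fun x => gm_frac m b y s x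
     + - ((s' - s) * b * exp (- b * s * y)) * gm m (b * (1 + s)) x) (gm_frac m b y s')).
  - apply cont_add; auto using cont_gm_frac; apply cont_mul; auto using cont_const, cont_gm.
  - apply cont_gm_frac; auto.
  - intros x Hx; unfold gm_frac.
    pose proof (gm_ge_0 m b x Hx) as Hg; pose proof (sq_add_pos x y Hy) as Hp.
    set (z := x ^ 2 + y) in *.
    replace (- ((s' - s) * b * exp (- b * s * y)) * gm m (b * (1 + s)) x)
      with (gm m b x * (- ((s' - s) * b * exp (- (b * s * z))))).
    + rewrite <- Rmult_plus_distr_l; apply Rmult_le_compat_l; auto.
      apply Rmult_le_reg_r with z; auto.
      replace (exp (- (b * s' * z)) / z * z) with (exp (- (b * s' * z))) by (field; lra).
      replace ((exp (- (b * s * z)) / z + - ((s' - s) * b * exp (- (b * s * z)))) * z)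
        with (exp (- (b * s * z)) * (1 + - (b * (s' - s) * z))) by (field; lra).
      replace (exp (- (b * s' * z))) with (exp (- (b * s * z)) * exp (- (b * (s' - s) * z)))
        by (rewrite <- exp_plus; f_equal; ring).
      apply Rmult_le_compat_l; [left; apply exp_pos|apply exp_ineq1_le].
    + unfold gm, z.
      replace (exp (- (b * (1 + s)) * x ^ 2)) with (exp (- b * x ^ 2) * exp (- b * s * x ^ 2))
        by (rewrite <- exp_plus; f_equal; ring).
      replace (exp (- (b * s * (x ^ 2 + y)))) with (exp (- b * s * x ^ 2) * exp (- b * s * y))
        by (rewrite <- exp_plus; f_equal; ring).
      ring.
  - apply improper_add; auto using cont_gm_frac.
    + apply cont_mul; auto using cont_const, cont_gm.
    + apply improper_gm_frac; auto.
    + apply improper_mul_l; auto using cont_gm, improper_gm.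
  - apply improper_gm_frac; auto.
Qed.

Lemma mu_even (j : nat) (c : R) : 0 < c ->
  mu (S (S (2 * j))) c = poch (3 / 2) j / c ^ j * (sqrt PI / (4 * (c * sqrt c))).
Proof.
  intros Hc; assert (0 < sqrt c) by (apply sqrt_lt_R0; auto).
  assert (0 < c ^ j) by (apply pow_lt; auto).
  induction j.
  - rewrite mu_SS, mu_0 by auto; simpl; field; lra.
  - rewrite mu_SS by auto.
    replace (2 * S j)%nat with (S (S (2 * j))) by lia.
    rewrite IHj by (apply pow_lt; auto); simpl poch; simpl (c ^ S j).
    replace (INR (S (S (S (2 * j))))) with (2 * (3 / 2 + INR j))
      by (rewrite !S_INR, mult_INR; simpl; field).
    field; repeat split; try lra; apply pow_nonzero; lra.
Qed.

Lemma mu_even_continuous (j : nat) (c : R) : 0 < c -> continuous (mu (S (S (2 * j)))) c.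
Proof.
  intros Hc.
  apply (continuous_ext_loc (mu (S (S (2 * j)))) (fun c => poch (3 / 2) j / c ^ j * (sqrt PI / (4 * (c * sqrt c))))).
  - exists (mkposreal c Hc); intros z Hz; symmetry; apply mu_even.
    change (Rabs (z - c) < c) in Hz; apply Rabs_def2 in Hz; lra.
  - assert (0 < sqrt c) by (apply sqrt_lt_R0; auto).
    apply ex_derive_cont; auto_derive; repeat split; auto.
    + apply pow_nonzero; lra.
    + apply Rgt_not_eq; apply Rmult_lt_0_compat; [|apply Rmult_lt_0_compat]; lra.
Qed.

(** Up to the factor [- exp (- b * t * y)], the derivative of [frac_int] in [t]. The exponent
    [2 j + 2] is that of a monomial [x^(2 j)] times the [x^2] of the partial fractions. *)
Definition heat_weight (j : nat) (b t : R) : R := b * mu (S (S (2 * j))) (b * (1 + t)).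

Lemma heat_weight_continuous (j : nat) (b t : R) : 0 < b -> 0 < t ->
  continuous (heat_weight j b) t.
Proof.
  intros Hb Ht; apply (continuous_mult (fun _ => b)); [apply continuous_const|].
  apply (continuous_comp (fun t => b * (1 + t)) (mu (S (S (2 * j))))).
  - apply ex_derive_cont; auto_derive; trivial.
  - apply mu_even_continuous; apply Rmult_lt_0_compat; lra.
Qed.

(** The interchange of the integrals over [x] and [t], obtained as the fundamental theorem of
    calculus for [frac_int]. *)
Lemma RInt_heat_weight (j : nat) (b y p q : R) : 0 < b -> 0 < y -> 0 < p <= q ->
  RInt (fun t => exp (- b * t * y) * heat_weight j b t) p q
  = frac_int (S (S (2 * j))) b y p - frac_int (S (S (2 * j))) b y q.
Proof.
  intros Hb Hy Hpq.
  assert (C : forall t, 0 < t -> continuous (fun t => exp (- b * t * y) * heat_weight j b t) t).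
  { intros t Ht; apply (continuous_mult (fun t => exp (- b * t * y)) (heat_weight j b)).
    - apply ex_derive_cont; auto_derive; trivial.
    - apply heat_weight_continuous; auto. }
  rewrite (RInt_FTC (fun t => - frac_int (S (S (2 * j))) b y t)); [eqR; lra| |].
  - intros t Ht; rewrite Rmin_left, Rmax_right in Ht by lra.
    eapply is_derive_eq.
    + apply (is_derive_opp (frac_int (S (S (2 * j))) b y) t
        (- (exp (- b * t * y) * heat_weight j b t))).
      apply (is_derive_of_tangents _ (fun t => - (exp (- b * t * y) * heat_weight j b t))).
      * apply (continuous_opp (fun t => exp (- b * t * y) * heat_weight j b t)), C; lra.
      * assert (Ht0 : 0 < t) by lra.
        exists (mkposreal t Ht0); intros z Hz.
        change (Rabs (z - t) < t) in Hz; apply Rabs_def2 in Hz.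
        split; apply frac_int_tangent; auto; lra.
    + unfold opp; simpl; ring.
  - intros t Ht; rewrite Rmin_left, Rmax_right in Ht by lra; apply C; lra.
Qed.

(** The contribution of all poles [n] to one monomial. It is never evaluated: it occurs alike in [J]
    and in [eps]. *)
Definition lattice_sum (m : nat) (b : R) : R :=
  Series (fun n => frac_int m b (INR (S n) ^ 2) 0).

Lemma INR_S_sq_pos (n : nat) : 0 < INR (S n) ^ 2.
Proof. apply pow_lt, INR_S_pos. Qed.

Lemma ex_series_frac_int (m : nat) (b : R) : 0 < b ->
  ex_series (fun n => frac_int m b (INR (S n) ^ 2) 0).
Proof.
  intros Hb; apply ex_series_dominated with (fun n => mu m b * / INR (S n) ^ 2).
  - intros n; destruct (improper_gm_frac_0 m b _ Hb (INR_S_sq_pos n)) as [_ H].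
    rewrite Rabs_pos_eq; lra.
  - apply (ex_series_scal_l (mu m b) (fun n => / INR (S n) ^ 2)), ex_series_inv_sq.
Qed.

Lemma theta_tail_continuous (c : R) : 0 < c -> continuous theta_tail c.
Proof.
  intros Hc; apply (continuous_Series (fun n c => exp (- c * INR (S n) ^ 2))
    (fun n => / (c / 2) * / INR (S n) ^ 2)).
  - assert (Hc2 : 0 < c / 2) by lra.
    exists (mkposreal _ Hc2); intros z Hz n.
    change (Rabs (z - c) < c / 2) in Hz; apply Rabs_def2 in Hz.
    eapply Rle_trans; [apply exp_sq_bound; lra|].
    apply Rmult_le_compat_r; [left; apply Rinv_0_lt_compat, INR_S_sq_pos|].
    apply Rinv_le_contravar; lra.
  - apply (ex_series_scal_l (/ (c / 2)) (fun n => / INR (S n) ^ 2)), ex_series_inv_sq.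
  - intros n; apply ex_derive_cont; auto_derive; trivial.
Qed.

Lemma theta_heat_continuous (j : nat) (b t : R) : 0 < b -> 0 < t ->
  continuous (fun t => theta_tail (b * t) * heat_weight j b t) t.
Proof.
  intros Hb Ht; apply (continuous_mult (fun t => theta_tail (b * t)) (heat_weight j b)).
  - apply (continuous_comp (fun t => b * t) theta_tail).
    + apply ex_derive_cont; auto_derive; trivial.
    + apply theta_tail_continuous, Rmult_lt_0_compat; auto.
  - apply heat_weight_continuous; auto.
Qed.

Lemma RInt_theta_heat (j : nat) (b p q : R) : 0 < b -> 0 < p <= q ->
  RInt (fun t => theta_tail (b * t) * heat_weight j b t) p q
  = Series (fun n => frac_int (S (S (2 * j))) b (INR (S n) ^ 2) p
                     - frac_int (S (S (2 * j))) b (INR (S n) ^ 2) q).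
Proof.
  intros Hb Hpq.
  assert (C : forall y t, 0 < t -> continuous (fun t => exp (- b * t * y) * heat_weight j b t) t).
  { intros y t Ht; apply (continuous_mult (fun t => exp (- b * t * y)) (heat_weight j b)).
    - apply ex_derive_cont; auto_derive; trivial.
    - apply heat_weight_continuous; auto. }
  destruct (continuous_bounded (heat_weight j b) p q ltac:(lra)) as (K & HK & HK').
  { intros t Ht; apply heat_weight_continuous; lra. }
  assert (E : forall t, Series (fun n => exp (- b * t * INR (S n) ^ 2) * heat_weight j b t)
    = theta_tail (b * t) * heat_weight j b t).
  { intros t; rewrite Series_scal_r; unfold theta_tail; f_equal; apply Series_ext; intros n.
    do 2 f_equal; ring. }
  rewrite <- (RInt_ext (fun t => Series (fun n => exp (- b * t * INR (S n) ^ 2) * heat_weight j b t)))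
    by (intros; apply E).
  symmetry; apply is_series_unique.
  apply is_series_ext with (fun n => RInt (fun t => exp (- b * t * INR (S n) ^ 2) * heat_weight j b t) p q).
  { intros n; apply RInt_heat_weight; auto using INR_S_sq_pos. }
  apply (is_series_RInt (fun n t => exp (- b * t * INR (S n) ^ 2) * heat_weight j b t)
    (fun n => K * / (b * p) * / INR (S n) ^ 2)).
  - lra.
  - intros n; apply (ex_RInt_continuous (fun t => exp (- b * t * INR (S n) ^ 2) * heat_weight j b t)).
    intros t Ht; rewrite Rmin_left, Rmax_right in Ht by lra; apply C; lra.
  - apply (ex_RInt_ext (fun t => theta_tail (b * t) * heat_weight j b t)).
    + intros; symmetry; apply E.
    + apply (ex_RInt_continuous (fun t => theta_tail (b * t) * heat_weight j b t)).
      intros t Ht; rewrite Rmin_left, Rmax_right in Ht by lra.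
      apply theta_heat_continuous; lra.
  - intros n t Ht; rewrite Rabs_mult.
    replace (K * / (b * p) * / INR (S n) ^ 2) with (/ (b * p) * / INR (S n) ^ 2 * K) by ring.
    apply Rmult_le_compat; auto using Rabs_pos.
    replace (- b * t) with (- (b * t)) by ring.
    eapply Rle_trans; [apply exp_sq_bound; apply Rmult_lt_0_compat; lra|].
    apply Rmult_le_compat_r; [left; apply Rinv_0_lt_compat, INR_S_sq_pos|].
    apply Rinv_le_contravar; [apply Rmult_lt_0_compat|apply Rmult_le_compat_l]; lra.
  - apply (ex_series_scal_l (K * / (b * p)) (fun n => / INR (S n) ^ 2)), ex_series_inv_sq.
Qed.

(** Termwise, [frac_int] at [/ T] tends to its value at [0] and at [T] to zero, all dominated by the
    value at [0]. The window [[/ T, T]] is chosen invariant under [t -> / t], as the later folding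
    requires. *)
Lemma is_lim_RInt_theta_heat (j : nat) (b : R) : 0 < b ->
  is_lim (fun T => RInt (fun t => theta_tail (b * t) * heat_weight j b t) (/ T) T) p_infty
    (lattice_sum (S (S (2 * j))) b).
Proof.
  intros Hb; set (m := S (S (2 * j))).
  assert (Hinv : forall T, 1 < T -> 0 < / T <= T).
  { intros T HT; split; [apply Rinv_0_lt_compat; lra|].
    apply Rle_trans with 1; [|lra]; rewrite <- Rinv_1; apply Rinv_le_contravar; lra. }
  apply (is_lim_ext_loc (fun T => Series (fun n => frac_int m b (INR (S n) ^ 2) (/ T)
     - frac_int m b (INR (S n) ^ 2) T))).
  { exists 1; intros T HT; symmetry; apply RInt_theta_heat; auto. }
  apply (filterlim_Series_dominated (Rbar_locally' p_infty)
    (fun n T => frac_int m b (INR (S n) ^ 2) (/ T) - frac_int m b (INR (S n) ^ 2) T) _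
    (fun n => frac_int m b (INR (S n) ^ 2) 0)).
  - apply ex_series_frac_int; auto.
  - exists 1; intros T HT n; specialize (Hinv T HT); pose proof (INR_S_sq_pos n) as Hn.
    destruct (improper_gm_frac m b _ (/ T) Hb Hn ltac:(lra)) as [_ H1].
    destruct (improper_gm_frac m b _ T Hb Hn ltac:(lra)) as [_ H2].
    destruct (improper_gm_frac_0 m b _ Hb Hn) as [_ H0].
    assert (He : forall s, 0 <= s -> exp (- (b * s * INR (S n) ^ 2)) <= 1).
    { intros s Hs; rewrite <- exp_0; apply exp_le_exp.
      assert (0 <= b * s * INR (S n) ^ 2) by (apply Rmult_le_pos; [apply Rmult_le_pos|]; lra); lra. }
    pose proof (He (/ T) ltac:(lra)); pose proof (He T ltac:(lra)).
    apply Rabs_le; nra.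
  - intros n; pose proof (INR_S_sq_pos n) as Hn.
    set (y := INR (S n) ^ 2) in *.
    destruct (improper_gm_frac_0 m b y Hb Hn) as [_ H0].
    match goal with |- filterlim ?f _ (locally ?l) => change (is_lim f p_infty (Finite l)) end.
    replace (Finite (frac_int m b y 0)) with (Finite (frac_int m b y 0 + (0 + 0))) by (f_equal; ring).
    apply is_lim_ext with (fun T => frac_int m b y 0
      + ((frac_int m b y (/ T) - frac_int m b y 0) + - frac_int m b y T)); [intros; ring|].
    apply is_lim_plus'; [apply is_lim_const|apply is_lim_plus'].
    + apply is_lim_squeeze_0 with (fun T => (b * mu m b) / T) 1; [|apply is_lim_inv_pinf].
      intros T HT; specialize (Hinv T HT).
      destruct (improper_gm_frac m b y (/ T) Hb Hn ltac:(lra)) as [_ H1].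
      assert (exp (- (b * / T * y)) <= 1).
      { rewrite <- exp_0; apply exp_le_exp.
        assert (0 <= b * / T * y) by (apply Rmult_le_pos; [apply Rmult_le_pos|]; lra); lra. }
      (* The tangent at [s = 0] bounds the loss between [0] and [/ T] linearly in [/ T]. *)
      pose proof (frac_int_tangent m b y 0 (/ T) Hb Hn ltac:(lra) ltac:(lra)) as Ht.
      replace (- b * 0 * y) with 0 in Ht by ring.
      replace (b * (1 + 0)) with b in Ht by ring.
      rewrite exp_0 in Ht; unfold Rdiv; apply Rabs_le; nra.
    + apply is_lim_squeeze_0 with (fun T => (frac_int m b y 0 / (b * y)) / T) 1; [|apply is_lim_inv_pinf].
      intros T HT; specialize (Hinv T HT).
      destruct (improper_gm_frac m b y T Hb Hn ltac:(lra)) as [_ H1].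
      rewrite Rabs_Ropp, Rabs_pos_eq by lra.
      eapply Rle_trans; [apply H1|].
      assert (Hp : 0 < b * T * y) by (apply Rmult_lt_0_compat; [apply Rmult_lt_0_compat|]; lra).
      pose proof (exp_opp_le_inv _ Hp).
      replace (frac_int m b y 0 / (b * y) / T) with (/ (b * T * y) * frac_int m b y 0)
        by (field; repeat split; lra).
      apply Rmult_le_compat_r; lra.
  - intros n; destruct (improper_gm_frac_0 m b _ Hb (INR_S_sq_pos n)) as [_ H].
    rewrite Rabs_pos_eq; lra.
Qed.

(** * Summing the partial fractions under the integral *)

Definition inv_sum (x : R) : R := Series (fun n => / (x ^ 2 + INR (S n) ^ 2)).

Lemma inv_sum_term_bound (x : R) (n : nat) :
  Rabs (/ (x ^ 2 + INR (S n) ^ 2)) <= / INR (S n) ^ 2.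
Proof.
  pose proof (INR_S_sq_pos n); pose proof (pow2_ge_0 x).
  rewrite Rabs_pos_eq by (left; apply Rinv_0_lt_compat; lra).
  apply Rinv_le_contravar; lra.
Qed.

Lemma cont_inv_sum : cont inv_sum.
Proof.
  intros x; apply (continuous_Series (fun n x => / (x ^ 2 + INR (S n) ^ 2)) (fun n => / INR (S n) ^ 2)).
  - apply filter_forall; intros; apply inv_sum_term_bound.
  - apply ex_series_inv_sq.
  - intros n; apply ex_derive_cont; auto_derive.
    pose proof (INR_S_sq_pos n) as Hn; pose proof (sq_add_pos x _ Hn) as H.
    simpl pow in H; apply Rgt_not_eq, H.
Qed.

(** A sandwich in place of a convergence theorem: the integrand lies between its partial sum and
    that partial sum plus a tail of the series of [/ n^2] times the Gaussian monomial. Integrated,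
    the gap is the tail times [mu m b]. *)
Lemma improper_inv_sum (m : nat) (b : R) : 0 < b ->
  improper (fun x => gm m b x * inv_sum x) (lattice_sum m b).
Proof.
  intros Hb; set (Z := Series (fun n => / INR (S n) ^ 2)).
  assert (Cf : cont (fun x => gm m b x * inv_sum x)).
  { apply cont_mul; auto using cont_gm, cont_inv_sum. }
  assert (Cs : forall M, cont (fun x => sum_f_R0 (fun n => gm_frac m b (INR (S n) ^ 2) 0 x) M)).
  { intros M x; apply (continuous_sum_f_R0 (fun n => gm_frac m b (INR (S n) ^ 2) 0)).
    intros n; apply cont_gm_frac, INR_S_sq_pos. }
  assert (Is : forall M, improper (fun x => sum_f_R0 (fun n => gm_frac m b (INR (S n) ^ 2) 0 x) M)
    (sum_f_R0 (fun n => frac_int m b (INR (S n) ^ 2) 0) M)).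
  { intros M; unfold improper.
    apply is_lim_ext with (fun B => sum_f_R0 (fun n => RInt (gm_frac m b (INR (S n) ^ 2) 0) 0 B) M).
    - intros B; symmetry; apply RInt_sum_f_R0; intros n.
      apply cont_ex_RInt, cont_gm_frac, INR_S_sq_pos.
    - apply (filterlim_sum_f_R0 (Rbar_locally' p_infty)
        (fun n B => RInt (gm_frac m b (INR (S n) ^ 2) 0) 0 B)).
      intros n; apply improper_gm_frac_0; auto using INR_S_sq_pos. }
  assert (Hs : forall M x, sum_f_R0 (fun n => gm_frac m b (INR (S n) ^ 2) 0 x) M
    = gm m b x * sum_f_R0 (fun n => / (x ^ 2 + INR (S n) ^ 2)) M).
  { intros M x; rewrite scal_sum; apply sum_eq; intros n _; unfold gm_frac.
    rewrite Rmult_0_r, Rmult_0_l, Ropp_0, exp_0; unfold Rdiv; ring. }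
  assert (Ht : forall M x, 0 <= inv_sum x - sum_f_R0 (fun n => / (x ^ 2 + INR (S n) ^ 2)) M
    <= Z - sum_f_R0 (fun n => / INR (S n) ^ 2) M).
  { intros M x; split.
    - unfold inv_sum; rewrite (Series_tail (fun n => / (x ^ 2 + INR (S n) ^ 2))).
      + apply Series_ge_0.
        * intros n; left; apply Rinv_0_lt_compat, sq_add_pos, INR_S_sq_pos.
        * apply (ex_series_incr_n (fun n => / (x ^ 2 + INR (S n) ^ 2)) (S M)).
          apply ex_series_dominated with (2 := ex_series_inv_sq); intros; apply inv_sum_term_bound.
      + apply ex_series_dominated with (2 := ex_series_inv_sq); intros; apply inv_sum_term_bound.
    - eapply Rle_trans; [apply Rle_abs|]; apply Series_tail_bound; [|apply ex_series_inv_sq].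
      intros; apply inv_sum_term_bound. }
  assert (Hge : forall x, 0 <= x -> 0 <= gm m b x * inv_sum x).
  { intros x Hx; apply Rmult_le_pos; [apply gm_ge_0; auto|].
    apply Series_ge_0.
    - intros n; left; apply Rinv_0_lt_compat, sq_add_pos, INR_S_sq_pos.
    - apply ex_series_dominated with (2 := ex_series_inv_sq); intros; apply inv_sum_term_bound. }
  assert (Hup : forall M x, 0 <= x -> gm m b x * inv_sum x
    <= sum_f_R0 (fun n => gm_frac m b (INR (S n) ^ 2) 0 x) M
       + (Z - sum_f_R0 (fun n => / INR (S n) ^ 2) M) * gm m b x).
  { intros M x Hx; rewrite Hs; specialize (Ht M x); pose proof (gm_ge_0 m b x Hx); nra. }
  assert (Ihi : forall M, improper (fun x => sum_f_R0 (fun n => gm_frac m b (INR (S n) ^ 2) 0 x) M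
       + (Z - sum_f_R0 (fun n => / INR (S n) ^ 2) M) * gm m b x)
     (sum_f_R0 (fun n => frac_int m b (INR (S n) ^ 2) 0) M
       + (Z - sum_f_R0 (fun n => / INR (S n) ^ 2) M) * mu m b)).
  { intros M; apply improper_add; auto.
    - apply cont_mul; auto using cont_const, cont_gm.
    - apply improper_mul_l; auto using cont_gm, improper_gm. }
  assert (Chi : forall M, cont (fun x => sum_f_R0 (fun n => gm_frac m b (INR (S n) ^ 2) 0 x) M
       + (Z - sum_f_R0 (fun n => / INR (S n) ^ 2) M) * gm m b x)).
  { intros M; apply cont_add; auto; apply cont_mul; auto using cont_const, cont_gm. }
  destruct (improper_dominated _ _ _ Cf (Chi 0%nat)
    (fun x Hx => conj (Hge x Hx) (Hup 0%nat x Hx)) (Ihi 0%nat)) as [HI _].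
  replace (lattice_sum m b) with (improper_value (fun x => gm m b x * inv_sum x)); auto.
  symmetry; apply is_series_unique, is_series_eps; intros eps He.
  assert (Hmu : 0 <= mu m b).
  { apply Rle_trans with (RInt (gm m b) 0 0); [rewrite RInt_point; apply Rle_refl|].
    apply RInt_gm_le_mu; auto; lra. }
  destruct (Series_tail_small (fun n => / INR (S n) ^ 2) (eps / (mu m b + 1)) ex_series_inv_sq)
    as [N HN]; [apply Rdiv_lt_0_compat; lra|].
  exists N; intros M HM; specialize (HN M HM); fold Z in HN.
  pose proof (improper_le _ _ _ _ Cf (Chi M) (Hup M) HI (Ihi M)) as U.
  assert (Lo : sum_f_R0 (fun n => frac_int m b (INR (S n) ^ 2) 0) M
    <= improper_value (fun x => gm m b x * inv_sum x)).
  { apply (improper_le _ _ _ _ (Cs M) Cf) with (2 := Is M) (3 := HI).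
    intros x Hx; rewrite Hs; specialize (Ht M x); pose proof (gm_ge_0 m b x Hx); nra. }
  assert ((Z - sum_f_R0 (fun n => / INR (S n) ^ 2) M) * mu m b <= eps / (mu m b + 1) * mu m b)
    by (apply Rmult_le_compat_r; lra).
  assert (eps / (mu m b + 1) * mu m b < eps).
  { apply Rlt_le_trans with (eps / (mu m b + 1) * (mu m b + 1)).
    - apply Rmult_lt_compat_l; [apply Rdiv_lt_0_compat; lra|lra].
    - right; field; lra. }
  apply Rabs_def1; lra.
Qed.

(** The continuous extension of [x / (exp (2 * PI * x) - 1)], with the true limit [/ (2 * PI)] at
    [0], where the quotient itself reads [0]. *)
Definition bose (x : R) : R := - (x / 2) + / (2 * PI) + / PI * (x ^ 2 * inv_sum x).

Lemma bose_eq (x : R) : 0 < x -> x / (exp (2 * PI * x) - 1) = bose x.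
Proof.
  intros Hx; rewrite bose_partial_fractions by auto; unfold bose, inv_sum.
  rewrite <- (Series_scal_l (x ^ 2)); reflexivity.
Qed.

Lemma cont_bose : cont bose.
Proof.
  apply cont_add.
  - intros x; apply ex_derive_cont; auto_derive; trivial.
  - apply cont_mul; [apply cont_const|]; apply cont_mul; [|apply cont_inv_sum].
    intros x; apply ex_derive_cont; auto_derive; trivial.
Qed.

Lemma improper_gm_bose (m : nat) (b : R) : 0 < b ->
  improper (fun x => gm m b x * bose x)
    (- / 2 * mu (S m) b + (/ (2 * PI) * mu m b + / PI * lattice_sum (S (S m)) b)).
Proof.
  intros Hb.
  apply improper_ext with (fun x => - / 2 * gm (S m) b x
    + (/ (2 * PI) * gm m b x + / PI * (gm (S (S m)) b x * inv_sum x))).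
  { intros x _; unfold bose, gm; simpl pow; unfold Rdiv; ring. }
  apply improper_add; [| |apply improper_mul_l|apply improper_add; [| |apply improper_mul_l|apply improper_mul_l]];
    auto using cont_gm, improper_gm, improper_inv_sum.
  - apply cont_mul; auto using cont_const, cont_gm.
  - apply cont_add; apply cont_mul; auto using cont_const, cont_gm.
    apply cont_mul; auto using cont_gm, cont_inv_sum.
  - apply cont_mul; auto using cont_const, cont_gm.
  - apply cont_mul; auto using cont_const; apply cont_mul; auto using cont_gm, cont_inv_sum.
  - apply cont_mul; auto using cont_gm, cont_inv_sum.
Qed.


(** * Terminating hypergeometric sums *)

Lemma Series_finite (u : nat -> R) (N : nat) :
  (forall n, (N < n)%nat -> u n = 0) -> Series u = sum_f_R0 u N.
Proof.
  intros H; apply is_series_unique, is_series_eps; intros eps He; exists N; intros M HM.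
  replace (sum_f_R0 u M) with (sum_f_R0 u N); [rewrite Rminus_diag, Rabs_R0; auto|].
  induction HM; auto; rewrite tech5, <- IHHM, H by lia; ring.
Qed.

Lemma poch_neg_INR_eq_0 (N j : nat) : (N < j)%nat -> poch (- INR N) j = 0.
Proof.
  induction j; intros Hj; [lia|]; simpl.
  destruct (Nat.eq_dec N j) as [->|Hne]; [ring|].
  rewrite IHj by lia; ring.
Qed.

Lemma poch_neg_INR (N j : nat) : (j <= N)%nat ->
  poch (- INR N) j / INR (Factorial.fact j) = (-1) ^ j * Binomial.C N j.
Proof.
  intros Hj; induction j.
  - simpl; unfold Binomial.C; rewrite Nat.sub_0_r; simpl; field; apply INR_fact_neq_0.
  - rewrite pascal_step3 by lia.
    replace ((-1) ^ S j * ((INR (N - j) / INR (S j)) * Binomial.C N j))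
      with (- ((-1) ^ j * Binomial.C N j) * INR (N - j) / INR (S j))
      by (simpl pow; field; apply not_0_INR; lia).
    rewrite <- IHj by lia; rewrite minus_INR by lia.
    change (Factorial.fact (S j)) with (S j * Factorial.fact j)%nat; rewrite mult_INR; simpl poch.
    field; split; [apply INR_fact_neq_0|apply not_0_INR; lia].
Qed.

Lemma poch_pos (c : R) (j : nat) : 0 < c -> 0 < poch c j.
Proof.
  intros Hc; induction j; simpl; [lra|].
  apply Rmult_lt_0_compat; auto; pose proof (pos_INR j); lra.
Qed.

Lemma poch_1 (j : nat) : poch 1 j = INR (Factorial.fact j).
Proof.
  induction j; [reflexivity|].
  change (Factorial.fact (S j)) with (S j * Factorial.fact j)%nat; rewrite mult_INR, S_INR; simpl; rewrite IHj; ring.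
Qed.

Lemma binomial_one_sub (z : R) (N : nat) :
  sum_f_R0 (fun j => Binomial.C N j * (- z) ^ j) N = (1 - z) ^ N.
Proof.
  replace (1 - z) with (- z + 1) by ring; rewrite binomial; apply sum_eq; intros j _.
  rewrite pow1; ring.
Qed.

(* The coefficients of [hyp1F1 (- INR N) (3 / 2) (2 * b * x ^ 2)] in powers of [x ^ 2]. *)
Definition coef (N : nat) (b : R) (j : nat) : R :=
  Binomial.C N j * (- (2 * b)) ^ j / poch (3 / 2) j.

Lemma hyp1F1_finite (N : nat) (b x : R) :
  hyp1F1 (- INR N) (3 / 2) (2 * b * x ^ 2) = sum_f_R0 (fun j => coef N b j * x ^ (2 * j)) N.
Proof.
  unfold hyp1F1; rewrite (Series_finite _ N).
  - apply sum_eq; intros j Hj; unfold coef.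
    pose proof (poch_pos (3 / 2) j ltac:(lra)).
    transitivity (poch (- INR N) j / INR (Factorial.fact j) / poch (3 / 2) j * (2 * b * x ^ 2) ^ j).
    + field; split; [apply INR_fact_neq_0|lra].
    + rewrite poch_neg_INR by auto.
      rewrite Rpow_mult_distr, <- pow_mult.
      replace (- (2 * b)) with (-1 * (2 * b)) by ring; rewrite (Rpow_mult_distr (-1)).
      field; lra.
  - intros j Hj; rewrite poch_neg_INR_eq_0 by auto; unfold Rdiv; ring.
Qed.

Lemma mu_odd (j : nat) (c : R) : 0 < c ->
  mu (S (2 * j)) c = INR (Factorial.fact j) / (2 * c ^ S j).
Proof.
  intros Hc; assert (0 < c ^ j) by (apply pow_lt; auto); induction j.
  - change (S (2 * 0)) with 1%nat; rewrite mu_1 by auto; simpl; field; lra.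
  - replace (S (2 * S j))%nat with (S (S (S (2 * j)))) by lia.
    assert (0 < c ^ j) by (apply pow_lt; auto).
    rewrite mu_SS, IHj by auto; change (Factorial.fact (S j)) with (S j * Factorial.fact j)%nat.
    rewrite mult_INR; replace (INR (S (S (2 * j)))) with (2 * INR (S j))
      by (rewrite !S_INR, mult_INR; simpl; ring).
    simpl pow; field; lra.
Qed.

(** The odd moment supplies [j!], which is [poch 1 j], and its power of [b] cancels that of [coef],
    leaving the argument [2]. This is the share of the term [- x / 2] of [bose]. *)
Lemma sum_coef_mu_odd (N : nat) (b : R) : 0 < b ->
  sum_f_R0 (fun j => coef N b j * mu (S (2 * j)) b) N
  = / (2 * b) * hyp2F1 (- INR N) 1 (3 / 2) 2.
Proof.
  intros Hb; unfold hyp2F1; rewrite (Series_finite _ N).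
  - rewrite scal_sum; apply sum_eq; intros j Hj; unfold coef.
    pose proof (poch_pos (3 / 2) j ltac:(lra)).
    assert (0 < b ^ j) by (apply pow_lt; auto).
    rewrite mu_odd, poch_1 by auto.
    transitivity (poch (- INR N) j / INR (Factorial.fact j) / poch (3 / 2) j
      * 2 ^ j * INR (Factorial.fact j) * / (2 * b)).
    + rewrite poch_neg_INR by auto.
      replace (- (2 * b)) with (-1 * (2 * b)) by ring; rewrite !Rpow_mult_distr; simpl pow.
      field; lra.
    + field; repeat split; try lra; apply INR_fact_neq_0.
  - intros j Hj; rewrite poch_neg_INR_eq_0 by auto; unfold Rdiv; ring.
Qed.

(** The integral of the kernel under [s = 1 / sqrt (1 + t)], up to a factor: [w = 1], [/ sqrt 2] and
    [0] stand for [t = 0], [1] and infinity. *)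
Definition kint (N : nat) (w : R) : R := RInt (fun s => (1 - 2 * s ^ 2) ^ N) 0 w.

Lemma cont_kint_integrand (N : nat) : cont (fun s => (1 - 2 * s ^ 2) ^ N).
Proof. intros x; apply ex_derive_cont; auto_derive; trivial. Qed.

Lemma is_derive_RInt_cont (f : R -> R) (a x : R) : cont f ->
  is_derive (fun y => RInt f a y) x (f x).
Proof.
  intros Cf; apply (is_derive_RInt f (fun y => RInt f a y) a x); auto.
  apply filter_forall; intros y; apply (RInt_correct f), cont_ex_RInt, Cf.
Qed.

Lemma is_derive_kint (N : nat) (w : R) : is_derive (kint N) w ((1 - 2 * w ^ 2) ^ N).
Proof. apply (is_derive_RInt_cont (fun s => (1 - 2 * s ^ 2) ^ N)), cont_kint_integrand. Qed.

Lemma cont_kint (N : nat) : cont (kint N).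
Proof. intros x; apply ex_derive_cont; eexists; apply is_derive_kint. Qed.

Lemma RInt_pow_0_1 (m : nat) : RInt (fun s => s ^ m) 0 1 = / INR (S m).
Proof.
  pose proof (INR_S_pos m).
  rewrite (RInt_FTC (fun s => s ^ S m / INR (S m))).
  - rewrite pow1, pow_ne_zero by lia; eqR; unfold Rdiv; ring.
  - intros x _; eapply is_derive_eq.
    + apply (is_derive_ext (fun s => / INR (S m) * s ^ S m)).
      * intros; apply Rmult_comm.
      * apply is_derive_scal, is_derive_pow_id.
    + eqR; field; lra.
  - intros x _; apply ex_derive_cont; auto_derive; trivial.
Qed.

Lemma kint_1 (N : nat) :
  kint N 1 = sum_f_R0 (fun j => Binomial.C N j * (- 2) ^ j / (2 * INR j + 1)) N.
Proof.
  assert (C : forall j, cont (fun s => s ^ (2 * j))).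
  { intros j x; apply ex_derive_cont; auto_derive; trivial. }
  unfold kint.
  rewrite (RInt_ext _ (fun s => sum_f_R0 (fun j => (Binomial.C N j * (- 2) ^ j) * s ^ (2 * j)) N)).
  - rewrite (RInt_sum_f_R0 (fun j s => (Binomial.C N j * (- 2) ^ j) * s ^ (2 * j))).
    + apply sum_eq; intros j _; rewrite RInt_mul_l, RInt_pow_0_1 by auto using cont_ex_RInt.
      rewrite S_INR, mult_INR; reflexivity.
    + intros j; apply ex_RInt_mul_l; auto using cont_ex_RInt.
  - intros s _; rewrite <- binomial_one_sub; apply sum_eq; intros j _.
    replace (- (2 * s ^ 2)) with (- 2 * s ^ 2) by ring.
    rewrite Rpow_mult_distr, <- pow_mult; ring.
Qed.

(** [poch (3 / 2) j] cancels between coefficient and moment and leaves [/ (2 j + 1)], the integral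
    of [s^(2 j)] over [[0, 1]]. This is the share of the constant term of [bose]. *)
Lemma sum_coef_mu_even (N : nat) (a : R) : 0 < a ->
  sum_f_R0 (fun j => coef N (PI * a) j * mu (2 * j) (PI * a)) N = kint N 1 / (2 * sqrt a).
Proof.
  intros Ha; pose proof PI_RGT_0; assert (Hb : 0 < PI * a) by nra.
  assert (0 < sqrt a) by (apply sqrt_lt_R0; auto).
  assert (0 < sqrt PI) by (apply sqrt_lt_R0; auto).
  rewrite kint_1; unfold Rdiv; rewrite (Rmult_comm _ (/ (2 * sqrt a))), scal_sum; apply sum_eq; intros j _; unfold coef.
  pose proof (poch_pos (3 / 2) j ltac:(lra)).
  assert (0 < (PI * a) ^ j) by (apply pow_lt; auto).
  (* The closed form starts at exponent [2 j + 2], so the moment of order [2 j] is solved from the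
     recurrence. *)
  pose proof (mu_SS (2 * j) (PI * a) Hb) as E; rewrite mu_even in E by auto.
  assert (E' : mu (2 * j) (PI * a)
    = 2 * (PI * a) / INR (S (2 * j)) * (poch (3 / 2) j / (PI * a) ^ j
       * (sqrt PI / (4 * (PI * a * sqrt (PI * a)))))).
  { rewrite E; field; repeat split; try lra; apply Rgt_not_eq, INR_S_pos. }
  assert (0 < 2 * INR j + 1) by (pose proof (pos_INR j); lra).
  rewrite E', sqrt_mult, S_INR, mult_INR by lra; simpl (INR 2).
  replace (- (2 * (PI * a))) with (- 2 * (PI * a)) by ring; rewrite (Rpow_mult_distr (- 2)).
  field; repeat split; try lra.
Qed.

(** The function [s (1 - 2 s^2)^(N + 1)] is integrated from its derivative; it vanishes at [0] and,
    since [2 w^2 = 1], also at [w]. *)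
Lemma kint_recurrence (N : nat) (w : R) : 2 * w ^ 2 = 1 ->
  (2 * INR N + 3) * kint (S N) w = (2 * INR N + 2) * kint N w.
Proof.
  intros Hw.
  assert (H : RInt (fun s => (2 * INR N + 3) * (1 - 2 * s ^ 2) ^ S N
      + - (2 * INR N + 2) * (1 - 2 * s ^ 2) ^ N) 0 w
    = w * (1 - 2 * w ^ 2) ^ S N - 0 * (1 - 2 * 0 ^ 2) ^ S N).
  { apply (RInt_FTC (fun s => s * (1 - 2 * s ^ 2) ^ S N)).
    - intros s _; eapply is_derive_eq.
      + apply (is_derive_mult (fun s => s) (fun s => (1 - 2 * s ^ 2) ^ S N) s).
        * apply is_derive_id.
        * apply (is_derive_comp (fun y => y ^ S N) (fun s => 1 - 2 * s ^ 2)).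
          -- apply is_derive_pow_id.
          -- auto_derive; [trivial|reflexivity].
        * intros; apply Rmult_comm.
      + unfold plus, mult, scal, one; cbn -[INR pow]; unfold mult; cbn -[INR pow].
        rewrite S_INR, <- tech_pow_Rmult; generalize ((1 - 2 * s ^ 2) ^ N); intros y; ring.
    - intros s _; apply cont_add; apply cont_mul; auto using cont_const, cont_kint_integrand. }
  rewrite RInt_add, !RInt_mul_l in H
    by auto using ex_RInt_mul_l, cont_ex_RInt, cont_kint_integrand.
  fold (kint (S N) w) (kint N w) in H.
  rewrite Hw, Rminus_diag, pow_i in H by lia; lra.
Qed.

Lemma kint_half (N : nat) :
  2 * kint N (/ sqrt 2) = sqrt 2 * INR (Factorial.fact N) / poch (3 / 2) N.
Proof.
  assert (H2 : 0 < sqrt 2) by (apply sqrt_lt_R0; lra).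
  assert (Hs : sqrt 2 * sqrt 2 = 2) by (apply sqrt_sqrt; lra).
  assert (Hw : 2 * (/ sqrt 2) ^ 2 = 1).
  { rewrite pow_inv; simpl (sqrt 2 ^ 2); rewrite Rmult_1_r, Hs; lra. }
  induction N.
  - unfold kint; simpl; rewrite RInt_const; unfold scal; simpl; unfold mult; simpl.
    rewrite Rminus_0_r, !Rmult_1_r; unfold Rdiv; rewrite Rinv_1, Rmult_1_r.
    apply Rmult_eq_reg_r with (sqrt 2); [|lra]; rewrite Hs; field; lra.
  - pose proof (poch_pos (3 / 2) N ltac:(lra)); pose proof (pos_INR N).
    pose proof (kint_recurrence N (/ sqrt 2) Hw) as E.
    change (Factorial.fact (S N)) with (S N * Factorial.fact N)%nat; rewrite mult_INR, S_INR; simpl poch.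
    apply Rmult_eq_reg_l with (2 * INR N + 3); [|lra].
    replace ((2 * INR N + 3) * (2 * kint (S N) (/ sqrt 2)))
      with (2 * ((2 * INR N + 3) * kint (S N) (/ sqrt 2))) by ring.
    rewrite E; replace (2 * ((2 * INR N + 2) * kint N (/ sqrt 2)))
      with ((2 * INR N + 2) * (2 * kint N (/ sqrt 2))) by ring.
    rewrite IHN; field; lra.
Qed.

(** * Integrals over filters *)

(** The fundamental theorem of calculus with endpoints given by filters on the positive reals: one
    statement covers the integrals of [J], [Gamma] and [eps]. *)
Lemma is_RInt_gen_pos (F f : R -> R) (Fa Fb : (R -> Prop) -> Prop) {FFa : Filter Fa} {FFb : Filter Fb}
  (la lb : R) : Fa (fun x => 0 < x) -> Fb (fun x => 0 < x) ->
  (forall x, 0 < x -> is_derive F x (f x)) -> (forall x, 0 < x -> continuous f x) ->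
  filterlim F Fa (locally la) -> filterlim F Fb (locally lb) ->
  is_RInt_gen f Fa Fb (lb - la).
Proof.
  intros Ha Hb HF Hf La Lb.
  assert (Hpos : forall p q x, 0 < p -> 0 < q -> Rmin p q <= x -> 0 < x).
  { intros p q x Hp Hq Hx; unfold Rmin in Hx; destruct (Rle_dec p q); lra. }
  apply (is_RInt_gen_ext (Derive F)).
  - apply (Filter_prod _ _ _ _ _ Ha Hb); intros p q Hp Hq x Hx; simpl in Hx.
    apply is_derive_unique, HF, (Hpos p q); auto; lra.
  - apply is_RInt_gen_Derive; auto.
    + apply (Filter_prod _ _ _ _ _ Ha Hb); intros p q Hp Hq x Hx; simpl in Hx.
      exists (f x); apply HF, (Hpos p q); auto; lra.
    + apply (Filter_prod _ _ _ _ _ Ha Hb); intros p q Hp Hq x Hx; simpl in Hx.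
      assert (Hx0 : 0 < x) by (apply (Hpos p q); auto; lra).
      apply (continuous_ext_loc (Derive F) f); auto.
      exists (mkposreal x Hx0); intros z Hz.
      change (Rabs (z - x) < x) in Hz; apply Rabs_def2 in Hz.
      symmetry; apply is_derive_unique, HF; lra.
Qed.

Lemma at_right_0_pos : at_right 0 (fun x => 0 < x).
Proof. unfold at_right, within; apply filter_forall; auto. Qed.

Lemma pinf_pos : Rbar_locally p_infty (fun x => 0 < x).
Proof. exists 0; auto. Qed.

Lemma filterlim_at_right_0 (F : R -> R) (l : R) :
  continuous F 0 -> F 0 = l -> filterlim F (at_right 0) (locally l).
Proof.
  intros H <-; apply (filterlim_filter_le_1 (F := locally 0)); auto.
  intros P HP; unfold at_right, within; generalize HP; apply filter_imp; auto.
Qed.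


Lemma is_RInt_gen_improper (f g : R -> R) (l : R) : cont g ->
  (forall x, 0 < x -> f x = g x) -> improper g l ->
  is_RInt_gen f (at_right 0) (Rbar_locally p_infty) l.
Proof.
  intros Cg Hfg Hg; replace l with (l - 0) by ring.
  apply (is_RInt_gen_pos (fun x => RInt g 0 x) f (at_right 0) (Rbar_locally p_infty)).
  - apply at_right_0_pos.
  - apply pinf_pos.
  - intros x Hx; rewrite Hfg by auto; apply is_derive_RInt_cont; auto.
  - intros x Hx; apply (continuous_ext_loc f g); auto.
    exists (mkposreal x Hx); intros z Hz.
    change (Rabs (z - x) < x) in Hz; apply Rabs_def2 in Hz; symmetry; apply Hfg; lra.
  - apply filterlim_at_right_0.
    + apply ex_derive_cont; eexists; apply is_derive_RInt_cont; auto.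
    + exact (RInt_point 0 g).
  - exact Hg.
Qed.

(* The substitution [t = x ^ 2]. *)
Lemma Gamma_half (m : nat) : Gamma (INR m / 2 + 1 / 2) = 2 * mu m 1.
Proof.
  unfold Gamma; apply is_RInt_gen_unique; replace (2 * mu m 1) with (2 * mu m 1 - 0) by ring.
  set (F := fun x => RInt (gm m 1) 0 x).
  assert (HF : forall x, is_derive F x (gm m 1 x)) by (intros; apply is_derive_RInt_cont, cont_gm).
  assert (CF : cont F) by (intros x; apply ex_derive_cont; eexists; apply HF).
  apply (is_RInt_gen_pos (fun t => 2 * F (sqrt t)) _ (at_right 0) (Rbar_locally p_infty)).
  - apply at_right_0_pos.
  - apply pinf_pos.
  - intros t Ht; assert (Hs : 0 < sqrt t) by (apply sqrt_lt_R0; auto).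
    eapply is_derive_eq.
    + apply is_derive_scal, (is_derive_comp F sqrt); [apply HF|].
      apply is_derive_Reals, derivable_pt_lim_sqrt; auto.
    + unfold scal; simpl; unfold mult; simpl; unfold gm.
      replace (- (1) * sqrt t ^ 2) with (- t) by (simpl; rewrite Rmult_1_r, sqrt_sqrt; lra).
      replace (INR m / 2 + 1 / 2 - 1) with (/ 2 * INR m + - / 2) by field.
      rewrite Rpower_plus, Rpower_Ropp, <- Rpower_mult, Rpower_sqrt, Rpower_pow by auto.
      field; lra.
  - intros t Ht; apply ex_derive_cont; unfold Rpower; auto_derive; auto.
  - apply filterlim_at_right_0.
    + apply (continuous_mult (fun _ => 2)); [apply continuous_const|].
      apply (continuous_comp sqrt F); [apply continuous_sqrt|apply CF].
    + rewrite sqrt_0; unfold F; rewrite RInt_point; exact (Rmult_0_r 2).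
  - match goal with |- filterlim ?f _ (locally ?l) => change (is_lim f p_infty (Finite l)) end.
    apply (is_lim_scal_l (fun t => F (sqrt t)) 2 p_infty (mu m 1)).
    apply (is_lim_comp F sqrt p_infty (mu m 1) p_infty).
    + apply improper_gm; lra.
    + apply (is_lim_sqrt_p (fun x => x)), is_lim_id.
    + exists 0; intros; discriminate.
Qed.

(** Both Gamma values are Gaussian moments at [c = 1], of orders [2 N + 1] and [2 N + 2]; their
    quotient contains the same [N! / poch (3 / 2) N] that solves the recurrence of [kint] at
    [/ sqrt 2]. *)
Lemma Gamma_ratio (N : nat) :
  sqrt (PI / 2) * (Gamma (INR N + 1) / Gamma (INR N + 3 / 2)) = 2 * kint N (/ sqrt 2).
Proof.
  pose proof PI_RGT_0; pose proof (poch_pos (3 / 2) N ltac:(lra)).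
  assert (H2 : 0 < sqrt 2) by (apply sqrt_lt_R0; lra).
  assert (Hs : sqrt 2 * sqrt 2 = 2) by (apply sqrt_sqrt; lra).
  assert (0 < sqrt PI) by (apply sqrt_lt_R0; lra).
  replace (INR N + 1) with (INR (S (2 * N)) / 2 + 1 / 2) by (rewrite S_INR, mult_INR; simpl; field).
  replace (INR N + 3 / 2) with (INR (S (S (2 * N))) / 2 + 1 / 2)
    by (rewrite !S_INR, mult_INR; simpl; field).
  rewrite !Gamma_half, mu_odd, mu_even, kint_half, pow1, pow1, sqrt_1, sqrt_div by lra.
  assert (E : / sqrt 2 * 2 = sqrt 2) by (rewrite <- Hs at 2; field; lra).
  rewrite <- E at 2; field; lra.
Qed.

(** * The kernel *)

Definition kern (N : nat) (t : R) : R := (t - 1) ^ N / Rpower (1 + t) (INR N + 3 / 2).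

Lemma kern_eq (N : nat) (t : R) : 0 < t ->
  kern N t = (1 - 2 / (1 + t)) ^ N / ((1 + t) * sqrt (1 + t)).
Proof.
  intros Ht; unfold kern.
  assert (0 < sqrt (1 + t)) by (apply sqrt_lt_R0; lra).
  assert (0 < (1 + t) ^ N) by (apply pow_lt; lra).
  replace (INR N + 3 / 2) with (INR N + 1 + / 2) by field.
  rewrite !Rpower_plus, Rpower_pow, Rpower_1, Rpower_sqrt by lra.
  replace (1 - 2 / (1 + t)) with ((t - 1) * / (1 + t)) by (field; lra).
  rewrite Rpow_mult_distr, pow_inv; field; lra.
Qed.

(** Under [t -> / t] the base [1 - 2 / (1 + t)] changes sign, which an even exponent hides;
    [(1 + t)^(3 / 2)] is divided by [t^(3 / 2)]. *)
Lemma kern_inv (k : nat) (t : R) : 0 < t -> kern (2 * k) (/ t) / t ^ 2 = kern (2 * k) t / sqrt t.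
Proof.
  intros Ht; assert (0 < / t) by (apply Rinv_0_lt_compat; auto).
  assert (0 < sqrt t) by (apply sqrt_lt_R0; auto).
  assert (0 < sqrt (1 + t)) by (apply sqrt_lt_R0; lra).
  rewrite !kern_eq by auto.
  replace (1 + / t) with ((1 + t) / t) by (field; lra).
  replace (1 - 2 / ((1 + t) / t)) with (- (1 - 2 / (1 + t))) by (field; lra).
  rewrite !(pow_mult _ 2), sqrt_div by lra.
  replace ((- (1 - 2 / (1 + t))) ^ 2) with ((1 - 2 / (1 + t)) ^ 2) by ring.
  assert (E : t ^ 2 = t * (sqrt t * sqrt t)) by (rewrite sqrt_sqrt by lra; ring).
  rewrite E; generalize (((1 - 2 / (1 + t)) ^ 2) ^ k) as z; intros z.
  field; repeat split; lra.
Qed.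

Lemma kern_continuous (N : nat) (t : R) : 0 < t -> continuous (kern N) t.
Proof.
  intros Ht; apply (continuous_ext_loc (kern N) (fun t => (1 - 2 / (1 + t)) ^ N / ((1 + t) * sqrt (1 + t)))).
  - exists (mkposreal t Ht); intros z Hz.
    change (Rabs (z - t) < t) in Hz; apply Rabs_def2 in Hz; symmetry; apply kern_eq; lra.
  - assert (0 < sqrt (1 + t)) by (apply sqrt_lt_R0; lra).
    apply ex_derive_cont; auto_derive; repeat split; try lra.
    apply Rgt_not_eq, Rmult_lt_0_compat; lra.
Qed.

(** The primitive of the kernel that vanishes at infinity; [- 2] comes from the derivative of
    [1 / sqrt (1 + t)]. *)
Definition kern_prim (N : nat) (t : R) : R := - 2 * kint N (/ sqrt (1 + t)).

Lemma is_derive_kern_prim (N : nat) (t : R) : 0 < t -> is_derive (kern_prim N) t (kern N t).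
Proof.
  intros Ht; assert (0 < sqrt (1 + t)) by (apply sqrt_lt_R0; lra).
  assert (E : sqrt (1 + t) * sqrt (1 + t) = 1 + t) by (apply sqrt_sqrt; lra).
  eapply is_derive_eq.
  - apply is_derive_scal, (is_derive_comp (kint N) (fun t => / sqrt (1 + t))).
    + apply is_derive_kint.
    + auto_derive; [split; [lra|split; auto; lra]|reflexivity].
  - unfold scal; simpl; unfold mult; simpl; rewrite kern_eq by auto.
    replace (1 - 2 * (/ sqrt (1 + t) * (/ sqrt (1 + t) * 1))) with (1 - 2 / (1 + t))
      by (rewrite <- E at 1; field; lra).
    generalize ((1 - 2 / (1 + t)) ^ N); intros z; rewrite E; field; lra.
Qed.

(** Here the parameter [3 / 2] matters: [poch (3 / 2) j] in [coef] cancels the one in the moment of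
    order [2 j + 2], leaving the binomial expansion of [(1 - 2 / (1 + t))^N]. *)
Lemma sum_coef_heat_weight (N : nat) (a t : R) : 0 < a -> 0 < t ->
  sum_f_R0 (fun j => coef N (PI * a) j * heat_weight j (PI * a) t) N = kern N t / (4 * sqrt a).
Proof.
  intros Ha Ht; pose proof PI_RGT_0; assert (Hb : 0 < PI * a) by nra.
  assert (0 < sqrt a) by (apply sqrt_lt_R0; auto).
  assert (0 < sqrt PI) by (apply sqrt_lt_R0; auto).
  assert (0 < sqrt (1 + t)) by (apply sqrt_lt_R0; lra).
  assert (Hbt : 0 < PI * a * (1 + t)) by (apply Rmult_lt_0_compat; lra).
  rewrite kern_eq, <- binomial_one_sub by auto.
  replace (sum_f_R0 (fun j => Binomial.C N j * (- (2 / (1 + t))) ^ j) N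
    / ((1 + t) * sqrt (1 + t)) / (4 * sqrt a)) with
    (/ ((1 + t) * sqrt (1 + t) * (4 * sqrt a))
     * sum_f_R0 (fun j => Binomial.C N j * (- (2 / (1 + t))) ^ j) N) by (field; lra).
  rewrite scal_sum; apply sum_eq; intros j _; unfold coef, heat_weight.
  pose proof (poch_pos (3 / 2) j ltac:(lra)).
  assert (0 < (PI * a) ^ j) by (apply pow_lt; auto).
  assert (0 < (1 + t) ^ j) by (apply pow_lt; lra).
  rewrite mu_even, (sqrt_mult (PI * a)), sqrt_mult by lra.
  replace (- (2 * (PI * a))) with (- 2 * (PI * a)) by ring.
  replace (- (2 / (1 + t))) with (- 2 * / (1 + t)) by (field; lra).
  rewrite !(Rpow_mult_distr (- 2)), (Rpow_mult_distr (PI * a)), pow_inv.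
  field; repeat split; lra.
Qed.

(** * Folding by [t -> / t] and the two evaluations *)

Lemma phi_theta_tail (a t : R) : phi a t = theta_tail (PI * a * t).
Proof. apply Series_ext; intros n; f_equal; ring. Qed.

Lemma psi_theta_tail (a t : R) : psi a t = theta_tail (PI * t / a).
Proof. apply Series_ext; intros n; f_equal; unfold Rdiv; ring. Qed.

(** The functional equation at [a / t]. The terms without [psi] are the source of the elementary
    integrals of the kernel. *)
Lemma phi_inv (a t : R) : 0 < a -> 0 < t ->
  sqrt a * phi a (/ t) = sqrt t * (1 / 2 + psi a t) - sqrt a / 2.
Proof.
  intros Ha Ht; rewrite phi_theta_tail, psi_theta_tail.
  assert (0 < sqrt t) by (apply sqrt_lt_R0; auto).
  pose proof (theta_functional (a / t) ltac:(apply Rdiv_lt_0_compat; auto)) as E.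
  replace (PI / (a / t)) with (PI * t / a) in E by (field; lra).
  replace (PI * (a / t)) with (PI * a * / t) in E by (unfold Rdiv; ring).
  rewrite sqrt_div in E by lra.
  replace (1 / 2 + theta_tail (PI * t / a)) with ((1 + 2 * theta_tail (PI * t / a)) / 2) by lra.
  rewrite E; field; lra.
Qed.

Definition phi_kern (N : nat) (a t : R) : R := phi a t * kern N t.

Lemma phi_continuous (a t : R) : 0 < a -> 0 < t -> continuous (phi a) t.
Proof.
  intros Ha Ht; apply (continuous_ext (fun t => theta_tail (PI * a * t))).
  - intros; symmetry; apply phi_theta_tail.
  - apply (continuous_comp (fun t => PI * a * t) theta_tail).
    + apply ex_derive_cont; auto_derive; trivial.
    + apply theta_tail_continuous; pose proof PI_RGT_0.
      apply (Rmult_lt_0_compat (PI * a) t); [apply Rmult_lt_0_compat|]; lra.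
Qed.

Lemma psi_continuous (a t : R) : 0 < a -> 0 < t -> continuous (psi a) t.
Proof.
  intros Ha Ht; apply (continuous_ext (fun t => theta_tail (PI * t / a))).
  - intros; symmetry; apply psi_theta_tail.
  - apply (continuous_comp (fun t => PI * t / a) theta_tail).
    + apply ex_derive_cont; auto_derive; lra.
    + apply theta_tail_continuous; pose proof PI_RGT_0.
      apply Rdiv_lt_0_compat; auto; apply Rmult_lt_0_compat; lra.
Qed.

Lemma phi_kern_continuous (N : nat) (a t : R) : 0 < a -> 0 < t -> continuous (phi_kern N a) t.
Proof.
  intros; apply (continuous_mult (phi a) (kern N)); auto using phi_continuous, kern_continuous.
Qed.

Lemma ex_RInt_phi_kern (N : nat) (a p q : R) : 0 < a -> 0 < p -> 0 < q -> ex_RInt (phi_kern N a) p q.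
Proof.
  intros Ha Hp Hq; apply (ex_RInt_continuous (phi_kern N a)); intros z Hz.
  apply phi_kern_continuous; auto; unfold Rmin in Hz; destruct (Rle_dec p q); lra.
Qed.

Lemma is_lim_RInt_phi_kern (N : nat) (a : R) : 0 < a ->
  is_lim (fun T => RInt (phi_kern N a) (/ T) T) p_infty
    (4 * sqrt a * sum_f_R0 (fun j => coef N (PI * a) j * lattice_sum (S (S (2 * j))) (PI * a)) N).
Proof.
  intros Ha; pose proof PI_RGT_0; assert (Hb : 0 < PI * a) by nra.
  assert (0 < sqrt a) by (apply sqrt_lt_R0; auto).
  apply is_lim_ext_loc with (fun T => 4 * sqrt a * sum_f_R0 (fun j =>
    coef N (PI * a) j * RInt (fun t => theta_tail (PI * a * t) * heat_weight j (PI * a) t) (/ T) T) N).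
  - exists 1; intros T HT.
    assert (HT' : 0 < / T) by (apply Rinv_0_lt_compat; lra).
    assert (HTT : / T <= T).
    { apply Rle_trans with 1; [|lra]; rewrite <- Rinv_1; apply Rinv_le_contravar; lra. }
    assert (Hex : forall j, ex_RInt (fun t => theta_tail (PI * a * t) * heat_weight j (PI * a) t) (/ T) T).
    { intros j; apply (ex_RInt_continuous (fun t => theta_tail (PI * a * t) * heat_weight j (PI * a) t)).
      intros z Hz; rewrite Rmin_left in Hz by auto; apply theta_heat_continuous; lra. }
    rewrite (RInt_ext _ (fun t => 4 * sqrt a * sum_f_R0 (fun j => coef N (PI * a) j *
      (theta_tail (PI * a * t) * heat_weight j (PI * a) t)) N)).
    + rewrite RInt_mul_l.
      * rewrite (RInt_sum_f_R0 (fun j t => coef N (PI * a) j *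
          (theta_tail (PI * a * t) * heat_weight j (PI * a) t))) by auto using ex_RInt_mul_l.
        f_equal; apply sum_eq; intros j _; rewrite RInt_mul_l; auto.
      * apply (ex_RInt_sum_f_R0 (fun j t => coef N (PI * a) j *
          (theta_tail (PI * a * t) * heat_weight j (PI * a) t))); auto using ex_RInt_mul_l.
    + intros t Ht; rewrite Rmin_left in Ht by auto; unfold phi_kern.
      rewrite (sum_eq _ (fun j => coef N (PI * a) j * heat_weight j (PI * a) t * theta_tail (PI * a * t)))
        by (intros; ring).
      rewrite <- scal_sum, sum_coef_heat_weight, phi_theta_tail by lra; eqR; field; lra.
  - apply (is_lim_scal_l _ (4 * sqrt a) p_infty (sum_f_R0 (fun j => coef N (PI * a) j *
      lattice_sum (S (S (2 * j))) (PI * a)) N)).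
    apply (filterlim_sum_f_R0 (Rbar_locally' p_infty) (fun j T => coef N (PI * a) j *
      RInt (fun t => theta_tail (PI * a * t) * heat_weight j (PI * a) t) (/ T) T)).
    intros j; apply (is_lim_scal_l _ (coef N (PI * a) j) p_infty (lattice_sum (S (S (2 * j))) (PI * a))).
    apply is_lim_RInt_theta_heat; auto.
Qed.

Lemma cont_sum_f_R0 (f : nat -> R -> R) (M : nat) : (forall n, cont (f n)) ->
  cont (fun y => sum_f_R0 (fun n => f n y) M).
Proof. intros H x; apply continuous_sum_f_R0; intros n; apply H. Qed.

Lemma improper_sum_f_R0 (f : nat -> R -> R) (l : nat -> R) (M : nat) : (forall n, cont (f n)) ->
  (forall n, improper (f n) (l n)) -> improper (fun y => sum_f_R0 (fun n => f n y) M) (sum_f_R0 l M).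
Proof.
  intros Hc H; induction M; simpl; auto.
  apply (improper_add (fun y => sum_f_R0 (fun n => f n y) M)); auto using cont_sum_f_R0.
Qed.

(** The three terms of [bose] yield the three terms here: [- x / 2] the Gauss function, the constant
    the value [kint (2 * k) 1], the partial fractions the lattice sums. *)
Lemma J_value (k : nat) (a : R) : 0 < a ->
  J k a = / (4 * PI * a) * (sqrt a * kint (2 * k) 1 - hyp2F1 (- INR (2 * k)) 1 (3 / 2) 2
    + 4 * a * sum_f_R0 (fun j => coef (2 * k) (PI * a) j
        * lattice_sum (S (S (2 * j))) (PI * a)) (2 * k)).
Proof.
  intros Ha; pose proof PI_RGT_0; assert (Hb : 0 < PI * a) by nra.
  assert (Hs : 0 < sqrt a) by (apply sqrt_lt_R0; auto).
  assert (Hss : sqrt a * sqrt a = a) by (apply sqrt_sqrt; lra).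
  set (N := (2 * k)%nat).
  apply is_RInt_gen_unique.
  apply (is_RInt_gen_improper _ (fun x => sum_f_R0 (fun j =>
    coef N (PI * a) j * (gm (2 * j) (PI * a) x * bose x)) N)).
  - apply (cont_sum_f_R0 (fun j x => coef N (PI * a) j * (gm (2 * j) (PI * a) x * bose x))).
    intros j; apply cont_mul; auto using cont_const; apply cont_mul; auto using cont_gm, cont_bose.
  - intros x Hx.
    replace (2 * PI * a * x ^ 2) with (2 * (PI * a) * x ^ 2) by ring.
    rewrite hyp1F1_finite.
    replace (x * exp (- PI * a * x ^ 2) / (exp (2 * PI * x) - 1))
      with (exp (- PI * a * x ^ 2) * bose x) by (rewrite <- bose_eq by auto; unfold Rdiv; ring).
    rewrite scal_sum; apply sum_eq; intros j _; unfold gm.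
    replace (- PI * a * x ^ 2) with (- (PI * a) * x ^ 2) by ring.
    fold N; ring.
  - match goal with |- improper _ ?l => replace l with (sum_f_R0 (fun j => coef N (PI * a) j *
      (- / 2 * mu (S (2 * j)) (PI * a) + (/ (2 * PI) * mu (2 * j) (PI * a)
         + / PI * lattice_sum (S (S (2 * j))) (PI * a)))) N) end.
    + apply (improper_sum_f_R0 (fun j x => coef N (PI * a) j * (gm (2 * j) (PI * a) x * bose x))).
      * intros j; apply cont_mul; auto using cont_const; apply cont_mul; auto using cont_gm, cont_bose.
      * intros j; apply improper_mul_l; [apply cont_mul; auto using cont_gm, cont_bose|].
        apply improper_gm_bose; auto.
    + rewrite (sum_eq _ (fun j => (coef N (PI * a) j * mu (S (2 * j)) (PI * a)) * - / 2
        + ((coef N (PI * a) j * mu (2 * j) (PI * a)) * / (2 * PI)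
         + (coef N (PI * a) j * lattice_sum (S (S (2 * j))) (PI * a)) * / PI))) by (intros; ring).
      rewrite !sum_plus, <- !scal_sum, sum_coef_mu_odd, sum_coef_mu_even by auto.
      set (L := sum_f_R0 _ N); set (h := hyp2F1 _ _ _ _).
      (* Writing [a] as [s * s] with [s = sqrt a] turns the goal into a rational identity. *)
      clearbody L h; clear Hb; revert Hs Hss; generalize (sqrt a); intros s Hs <-.
      field; repeat split; lra.
Qed.

(** An explicit primitive [E] of the integrand carries the folding, so no change of variables is
    made inside an integral; the value is the limit of [E] at infinity minus [E 1]. *)
Lemma eps_value (k : nat) (a : R) : 0 < a ->
  eps k a = / (4 * PI * a) * (sqrt a * kint (2 * k) 1 - (1 + sqrt a) * kint (2 * k) (/ sqrt 2)
    + 4 * a * sum_f_R0 (fun j => coef (2 * k) (PI * a) j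
        * lattice_sum (S (S (2 * j))) (PI * a)) (2 * k)).
Proof.
  intros Ha; unfold eps; f_equal.
  assert (Hs : 0 < sqrt a) by (apply sqrt_lt_R0; auto).
  assert (Hss : sqrt a * sqrt a = a) by (apply sqrt_sqrt; lra).
  set (L := sum_f_R0 _ _); set (N := (2 * k)%nat).
  set (P := fun x => RInt (phi_kern N a) 1 x).
  assert (HP : forall x, 0 < x -> is_derive P x (phi_kern N a x)).
  { intros x Hx; apply (is_derive_RInt (phi_kern N a) P 1 x).
    - exists (mkposreal x Hx); intros z Hz.
      change (Rabs (z - x) < x) in Hz; apply Rabs_def2 in Hz.
      apply (RInt_correct (phi_kern N a)), ex_RInt_phi_kern; lra.
    - apply phi_kern_continuous; auto. }
  (* [P t - P (/ t)] is the integral of [phi_kern] over [[/ t, t]]. The part in [kern_prim]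
     compensates the terms without [psi] that [phi_inv] produces. *)
  set (E := fun t => sqrt a * (P t - P (/ t)) - (kern_prim N t + sqrt a * kern_prim N (/ t)) / 2).
  apply is_RInt_gen_unique.
  match goal with |- is_RInt_gen _ _ _ ?l =>
    replace l with ((sqrt a * kint N 1 + 4 * a * L) - E 1) end.
  - apply (is_RInt_gen_pos E _ (at_point 1) (Rbar_locally p_infty)).
    + exact Rlt_0_1.
    + apply pinf_pos.
    + intros t Ht; assert (Ht' : 0 < / t) by (apply Rinv_0_lt_compat; auto).
      assert (Hst : 0 < sqrt t) by (apply sqrt_lt_R0; auto).
      assert (Dinv : is_derive (fun t => / t) t (- / t ^ 2)).
      { auto_derive; [lra|field; lra]. }
      assert (D1 : is_derive (fun t => P (/ t)) t (- / t ^ 2 * phi_kern N a (/ t))).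
      { apply (is_derive_comp P (fun t => / t)); auto. }
      assert (D2 : is_derive (fun t => kern_prim N (/ t)) t (- / t ^ 2 * kern N (/ t))).
      { apply (is_derive_comp (kern_prim N) (fun t => / t)); auto; apply is_derive_kern_prim; auto. }
      pose proof (is_derive_kern_prim N t Ht) as D3.
      eapply is_derive_eq.
      * apply (is_derive_minus (fun t => sqrt a * (P t - P (/ t)))
          (fun t => (kern_prim N t + sqrt a * kern_prim N (/ t)) / 2) t).
        -- apply is_derive_scal, (is_derive_minus P (fun t => P (/ t)) t); eauto.
        -- apply (is_derive_ext (fun t => / 2 * (kern_prim N t + sqrt a * kern_prim N (/ t)))).
           ++ intros; apply Rmult_comm.
           ++ apply is_derive_scal, (is_derive_plus (kern_prim N) (fun t => sqrt a * kern_prim N (/ t)) t); eauto.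
              apply is_derive_scal; eauto.
      * unfold minus, plus, opp; cbn -[pow Nat.mul]; unfold phi_kern; fold N.
        transitivity (sqrt a * phi a t * kern N t - kern N t / 2
          + (sqrt a * phi a (/ t) + sqrt a / 2) * (kern N (/ t) / t ^ 2)); [field; lra|].
        change ((t - 1) ^ N / Rpower (1 + t) (INR N + 3 / 2)) with (kern N t).
        unfold N; rewrite kern_inv, phi_inv by auto; field; lra.
    + intros t Ht.
      apply (continuous_mult (fun t => psi a t + sqrt a * phi a t) (kern N)).
      * apply (continuous_plus (psi a) (fun t => sqrt a * phi a t)); [apply psi_continuous; auto|].
        apply (continuous_mult (fun _ => sqrt a) (phi a)); [apply continuous_const|].
        apply phi_continuous; auto.
      * apply kern_continuous; auto.
    + intros Q HQ; apply (locally_singleton _ _ HQ).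
    + match goal with |- filterlim ?f _ (locally ?l) => change (is_lim f p_infty (Finite l)) end.
      assert (LK : is_lim (fun t => / sqrt (1 + t)) p_infty 0).
      { apply (is_lim_inv (fun t => sqrt (1 + t)) p_infty p_infty); [|discriminate].
        apply is_lim_sqrt_p; eapply is_lim_plus; [apply is_lim_const|apply is_lim_id|reflexivity]. }
      assert (Li : is_lim (fun t => / t) p_infty 0).
      { apply (is_lim_inv (fun t => t) p_infty p_infty); [apply is_lim_id|discriminate]. }
      (* The limit of [E] in the shape its pieces give: the window integral tends to
         [4 * sqrt a * L], [/ T] to [0] in one primitive, and [/ sqrt (1 + T)] to [0] in the
         other. *)
      replace (sqrt a * kint N 1 + 4 * a * L) with
        (sqrt a * (4 * sqrt a * L) + (- / 2 * kern_prim N 0 * sqrt a + 1 * kint N 0)).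
      * apply (is_lim_ext_loc (fun T => sqrt a * RInt (phi_kern N a) (/ T) T
          + (- / 2 * kern_prim N (/ T) * sqrt a + 1 * kint N (/ sqrt (1 + T))))).
        { exists 0; intros T HT; unfold E, P, kern_prim.
          assert (0 < / T) by (apply Rinv_0_lt_compat; auto).
          rewrite (RInt_split (phi_kern N a) 1 (/ T) T) by (apply ex_RInt_phi_kern; auto; lra).
          lra. }
        apply is_lim_plus'; [|apply is_lim_plus'].
        -- apply (is_lim_scal_l _ (sqrt a) p_infty (4 * sqrt a * L)), is_lim_RInt_phi_kern; auto.
        -- apply (is_lim_comp_continuous (fun T => / T) (fun y => - / 2 * kern_prim N y * sqrt a) p_infty 0 Li).
           apply (continuous_mult (fun y => - / 2 * kern_prim N y) (fun _ => sqrt a)); [|apply continuous_const].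
           apply (continuous_mult (fun _ => - / 2) (kern_prim N)); [apply continuous_const|].
           apply (continuous_mult (fun _ => - 2)); [apply continuous_const|].
           apply (continuous_comp (fun t => / sqrt (1 + t)) (kint N)); [|apply cont_kint].
           apply ex_derive_cont; auto_derive; rewrite Rplus_0_r, sqrt_1; lra.
        -- apply (is_lim_scal_l _ 1 p_infty (kint N 0)).
           apply (is_lim_comp_continuous (fun T => / sqrt (1 + T)) (kint N) p_infty 0 LK), cont_kint.
      * unfold kern_prim; rewrite Rplus_0_r, sqrt_1, Rinv_1.
        replace (kint N 0) with 0 by (unfold kint; rewrite RInt_point; reflexivity).
        replace (sqrt a * (4 * sqrt a * L)) with (4 * (sqrt a * sqrt a) * L) by ring.
        rewrite Hss; field.
  - unfold E, kern_prim; rewrite Rinv_1, Rminus_diag; replace (1 + 1) with 2 by ring; field.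
Qed.

Theorem theorem1 (a : R) (k : nat) (ha : 0 < a) (hk : (1 <= k)%nat) :
  J k a = T k a + eps k a.
Proof.
  rewrite J_value, eps_value by auto; unfold T.
  rewrite (Rmult_assoc ((1 + sqrt a) / 2)), Gamma_ratio; field; split; [lra|apply PI_neq0].
Qed.
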